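(* Let $\zeta(3)=\sum_{n=1}^\infty n^{-3}$ and $A_n=\sum_{k=0}^{n}\binom{n}{k}^2\binom{n+k}{k}^2$. Then $\zeta(3)$ is algebraic of degree two over $\mathbb{Q}$ if and only if the four-term recurrence relation $$\begin{aligned} &(n+3)^3(n+2)^6(2n+1)(17n^2+17n+5)\,z_{n+2}\\ &-(2n+1)(17n^2+17n+5)(1155n^6+13860n^5+68535n^4+178680n^3+259059n^2+198156n+62531)(n+2)^3\,z_{n+1}\\ &+(2n+5)(17n^2+85n+107)(1155n^6+6930n^5+16560n^4+20040n^3+12954n^2+4308n+584)(n+1)^3\,z_n\\ &-(n+1)^6n^3(2n+5)(17n^2+85n+107)\,z_{n-1}=0,\qquad n\ge1, \end{aligned}$$ has a non-trivial solution $(S_n)$ with $S_n\in\mathbb{Q}$ for every $n\ge1$ and $$\frac{S_n}{A_nA_{n-1}}\to 0\quad (n\to\infty).$$ *)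

(* Defs.v *)
From mathcomp Require Import all_boot all_order all_algebra.
From mathcomp Require Import all_classical all_reals all_analysis.

Set Implicit Arguments.
Unset Strict Implicit.
Unset Printing Implicit Defensive.

Import Order.TTheory GRing.Theory Num.Theory.
Import numFieldNormedType.Exports.

Local Open Scope classical_set_scope.
Local Open Scope ring_scope.

Definition zeta3 (R : realType) : R :=
  limn [series (n.+1%:R ^- 3 : R)]_n.

Definition apery_A (n : nat) : nat :=
  (\sum_(k < n.+1) 'C(n, k) ^ 2 * 'C(n + k, k) ^ 2)%N.

Definition is_minimal_polynomial (R : realType) (x : R) (p : {poly rat}) : Prop :=
  [/\ p \is monic,
      root (map_poly ratr p) x
    & forall q : {poly rat},
        q != 0 -> root (map_poly ratr q) x -> (size p <= size q)%N].

(* [size p] is the degree of [p] plus one. *)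
Definition algebraic_of_degree (R : realType) (d : nat) (x : R) : Prop :=
  exists2 p : {poly rat}, is_minimal_polynomial x p & size p = d.+1.

(* The left-hand side of the recurrence at [n]; it is only used for [1 <= n],
   where [n.-1] is a genuine predecessor.  The suffix [%:R] makes the larger
   literals go through [nat], which abstracts them instead of building a unary
   numeral (a stack overflow); [ring] and [lra] handle the abstracted form. *)
Definition recurrence_lhs (R : realType) (z : nat -> R) (n : nat) : R :=
  let x : R := n%:R in
    (x + 3) ^+ 3 * (x + 2) ^+ 6 * (2 * x + 1)
      * (17 * x ^+ 2 + 17 * x + 5) * z n.+2
  - (2 * x + 1) * (17 * x ^+ 2 + 17 * x + 5)
      * (1155%:R * x ^+ 6 + 13860%:R * x ^+ 5 + 68535%:R * x ^+ 4
         + 178680%:R * x ^+ 3 + 259059%:R * x ^+ 2 + 198156%:R * x + 62531%:R)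
      * (x + 2) ^+ 3 * z n.+1
  + (2 * x + 5) * (17 * x ^+ 2 + 85 * x + 107)
      * (1155%:R * x ^+ 6 + 6930%:R * x ^+ 5 + 16560%:R * x ^+ 4
         + 20040%:R * x ^+ 3 + 12954%:R * x ^+ 2 + 4308%:R * x + 584)
      * (x + 1) ^+ 3 * z n
  - (x + 1) ^+ 6 * x ^+ 3 * (2 * x + 5)
      * (17 * x ^+ 2 + 85 * x + 107) * z n.-1.

(* The recurrence at [n = 1] involves [z 0], so a solution is indexed from 0. *)
Definition is_solution (R : realType) (z : nat -> R) : Prop :=
  forall n : nat, (1 <= n)%N -> recurrence_lhs z n = 0.

(* Main.v *)
(* Let B_n be Apery's companion sequence: A_n and B_n satisfy the same three-term
   recurrence and B_n / A_n tends to zeta(3).  The products A_{n+1} A_n,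
   A_{n+1} B_n + B_{n+1} A_n and B_{n+1} B_n span the solutions of the four-term
   recurrence, which are determined by their terms of index 0, 1 and 2, and
   dividing x A_{n+1} A_n + y (A_{n+1} B_n + B_{n+1} A_n) + z B_{n+1} B_n by
   A_{n+1} A_n gives x + 2 y zeta(3) + z zeta(3)^2 in the limit.  Since
   A_{n+1} / A_{n-1} stays between 1 and 34^2, the normalisation by A_n A_{n-1}
   has the same null solutions.  So a rational one exists iff zeta(3) is a root
   of a nonzero rational polynomial of degree at most two, and degree one is
   excluded by Apery's theorem.

   For the latter, 0 < zeta(3) - B_n / A_n <= 6 / A_n^2 by the Casoratian,
   2 lcm(1..n)^3 B_n is an integer, and lcm(1..n)^3 = O(32^n) while A_n grows at
   least like 33^n. *)

Require Import Defs.
From mathcomp Require Import all_boot all_order all_algebra.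
From mathcomp Require Import all_classical all_reals all_analysis.
From mathcomp Require Import ring lra zify.

Set Implicit Arguments.
Unset Strict Implicit.

Import Order.TTheory GRing.Theory Num.Theory.
Import numFieldNormedType.Exports.

Local Open Scope ring_scope.

(** * The Apery sequences and their recurrence *)

(** The square of this product is the summand of [apery_A]; the product itself stands in the
    denominators of [apery_c]. Below it is written t(n,k). *)
Definition binomial_pair (n k : nat) : nat := ('C(n, k) * 'C(n + k, k))%N.

Lemma binomial_pair0 (n : nat) : binomial_pair n 0 = 1%N.
Proof. by rewrite /binomial_pair !bin0. Qed.

Lemma binomial_pair_small (n k : nat) : (n < k)%N -> binomial_pair n k = 0%N.
Proof. by move=> ltnk; rewrite /binomial_pair bin_small. Qed.

Lemma binomial_pair_gt0 (n k : nat) : (k <= n)%N -> (0 < binomial_pair n k)%N.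
Proof. by move=> lekn; rewrite muln_gt0 !bin_gt0 lekn leq_addl. Qed.

(** The ratio t(n,k+1) / t(n,k) is (n-k)(n+k+1) / (k+1)^2. Since (n-k)(n+k+1) = n(n+1) - k(k+1),
    moving the negative part to the left avoids truncated subtraction and lets k exceed n. *)
Lemma binomial_pair_succ (n k : nat) :
  (k.+1 ^ 2 * binomial_pair n k.+1 + k * k.+1 * binomial_pair n k =
   n * n.+1 * binomial_pair n k)%N.
Proof.
case: (leqP k n) => [lekn|ltnk]; last by rewrite !binomial_pair_small ?muln0 // ltnW.
have e1 : (k.+1 * 'C(n, k.+1) = (n - k) * 'C(n, k))%N by rewrite mul_bin_left.
have e2 : (k.+1 * 'C(n + k.+1, k.+1) = (n + k).+1 * 'C(n + k, k))%N.
  by rewrite addnS mul_bin_diag.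
have -> : (k.+1 ^ 2 * binomial_pair n k.+1 =
           (k.+1 * 'C(n, k.+1)) * (k.+1 * 'C(n + k.+1, k.+1)))%N.
  by rewrite /binomial_pair; ring.
rewrite e1 e2 /binomial_pair; set x := 'C(n, k); set y := 'C(n + k, k).
by rewrite -{2 3 4}(subnK lekn); ring.
Qed.

Lemma binomial_pair_diag (n k : nat) :
  (k.+1 ^ 2 * binomial_pair n.+1 k.+1 =
   (n + k).+1 * (n + k).+2 * binomial_pair n k)%N.
Proof.
have e1 : (k.+1 * 'C(n.+1, k.+1) = n.+1 * 'C(n, k))%N by rewrite mul_bin_diag.
have e2 : (k.+1 * 'C(n.+1 + k.+1, k.+1) = (n + k).+2 * 'C((n + k).+1, k))%N.
  by rewrite addSn addnS mul_bin_diag.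
have e3 : (n.+1 * 'C((n + k).+1, k) = (n + k).+1 * 'C(n + k, k))%N.
  by have := mul_bin_down (n + k).+1 k; rewrite -addSn addnK.
have -> : (k.+1 ^ 2 * binomial_pair n.+1 k.+1 =
           (k.+1 * 'C(n.+1, k.+1)) * (k.+1 * 'C(n.+1 + k.+1, k.+1)))%N.
  by rewrite /binomial_pair; ring.
rewrite e1 e2.
have -> : (n.+1 * 'C(n, k) * ((n + k).+2 * 'C((n + k).+1, k)) =
   'C(n, k) * (n + k).+2 * (n.+1 * 'C((n + k).+1, k)))%N by ring.
by rewrite e3 /binomial_pair; ring.
Qed.

Lemma binomial_pair_incr (n k : nat) :
  (k.+1 ^ 2 * binomial_pair n k.+1 + k * (n + k).+1 * binomial_pair n k =
   n * (n + k).+1 * binomial_pair n k)%N.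
Proof. by have := binomial_pair_succ n k; nia. Qed.

Section Certificates.
Context {F : realFieldType}.
Implicit Types n k : nat.

Local Notation t n k := ((binomial_pair n k)%:R : F).

Lemma natr_add1_neq0 n : n%:R + 1 != 0 :> F.
Proof. by rewrite natr1 pnatr_eq0. Qed.

Lemma pair_succ n k :
  t n k.+1 = t n k * (n%:R - k%:R) * (n%:R + k%:R + 1) / (k%:R + 1) ^+ 2.
Proof.
have := binomial_pair_incr n k.
move: (binomial_pair n k) (binomial_pair n k.+1) => s s' /(congr1 (fun m => m%:R : F)).
rewrite !(natrD, natrM, natrX, =^~ natr1) => e.
have nz := natr_add1_neq0 k.
apply: (mulfI (expf_neq0 2 nz)).
rewrite -[LHS](addrK (k%:R * (n%:R + k%:R + 1) * s%:R)) e; field.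
exact: nz.
Qed.

Lemma pair_diag n k :
  t n.+1 k.+1 =
  t n k * (n%:R + k%:R + 1) * (n%:R + k%:R + 2) / (k%:R + 1) ^+ 2.
Proof.
have := binomial_pair_diag n k.
move: (binomial_pair n k) (binomial_pair n.+1 k.+1) => s s' /(congr1 (fun m => m%:R : F)).
rewrite !(natrD, natrM, natrX, =^~ natr1) => e.
have nz := natr_add1_neq0 k.
apply: (mulfI (expf_neq0 2 nz)).
rewrite e; field.
exact: nz.
Qed.

Lemma pair_row n k :
  t n k * (n%:R + k%:R + 1) = t n.+1 k * (n%:R + 1 - k%:R).
Proof.
case: k => [|k]; first by rewrite !binomial_pair0; ring.
rewrite pair_succ pair_diag -natr1; field.
exact: natr_add1_neq0.
Qed.

Lemma pair_below n k :
  t n k.+1 =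
  t n.+1 k * (n%:R + 1 - k%:R) * (n%:R - k%:R) / (k%:R + 1) ^+ 2.
Proof. by rewrite pair_succ -pair_row; field; exact: natr_add1_neq0. Qed.

(** This cubic factors as (2n+1)(17n^2+17n+5), which is where the factors of the four-term
    recurrence come from. *)
Definition apery_coef n : F := 34 * n%:R ^+ 3 + 51 * n%:R ^+ 2 + 27 * n%:R + 5.

Definition apery_rec (u : nat -> F) : Prop := forall n,
  (n%:R + 2) ^+ 3 * u n.+2 - apery_coef n.+1 * u n.+1 + (n%:R + 1) ^+ 3 * u n = 0.

Definition apery_op (w : nat -> nat -> F) n k : F :=
  (n%:R + 2) ^+ 3 * w n.+2 k - apery_coef n.+1 * w n.+1 k
  + (n%:R + 1) ^+ 3 * w n k.

(* The creative-telescoping certificates, here and in [apery_c_cert], are those of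
   Zagier and Cohen reported by van der Poorten. *)
Definition apery_cert n k : F :=
  4 * (2 * n%:R + 1) * (k%:R * (2 * k%:R + 1) - (2 * n%:R + 1) ^+ 2).

(** Every value of t involved is a rational multiple of t(n+1,k), so the claim is an identity of
    rational functions times the square of t(n+1,k). Column 0 has no predecessor and is left to the
    summation. *)
Lemma apery_cert_telescope n k :
  apery_op (fun m j => t m j ^+ 2) n k.+1 =
  apery_cert n.+1 k.+1 * t n.+1 k.+1 ^+ 2 - apery_cert n.+1 k * t n.+1 k ^+ 2.
Proof.
rewrite /apery_op /apery_cert /apery_coef (pair_diag n.+1) (pair_below n) (pair_succ n.+1).
rewrite -!natr1; move: (t n.+1 k) => s; field.
exact: natr_add1_neq0.
Qed.

(* For n < i.+1 the summand is a division by [t n i.+1 = 0], hence 0; these values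
   only ever occur multiplied by [t n k = 0]. *)
Definition apery_c n k : F :=
  \sum_(i < n) i.+1%:R ^- 3
  + \sum_(i < k) (-1) ^+ i / (2 * i.+1%:R ^+ 3 * t n i.+1).

Lemma apery_cS n k :
  apery_c n k.+1 =
  apery_c n k + (-1) ^+ k / (2 * k.+1%:R ^+ 3 * t n k.+1).
Proof. by rewrite /apery_c big_ord_recr addrA. Qed.

Lemma pair_neq0 n k : (k <= n)%N -> t n k != 0.
Proof. by move=> lekn; rewrite pnatr_eq0 -lt0n binomial_pair_gt0. Qed.

(** Induction on k: the base is the new term 1/(n+1)^3 of the harmonic part, and each difference of
    alternating terms merges with the previous closed form into the next one. *)
Lemma apery_c_row n k : (k <= n)%N ->
  apery_c n.+1 k - apery_c n k =
  (-1) ^+ k / ((n%:R + 1) ^+ 2 * (n%:R + 1 + k%:R) * t n k).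
Proof.
elim: k => [_|k IH ltkn].
  rewrite /apery_c !big_ord0 !addr0 big_ord_recr /= addrAC subrr add0r.
  by rewrite binomial_pair0 -natr1; field; exact: natr_add1_neq0.
have {}IH := IH (ltnW ltkn).
have t0 := pair_neq0 (ltnW ltkn).
have nk0 : n%:R - k%:R != 0 :> F by rewrite subr_eq0 eqr_nat gtn_eqF.
have n0 : 0 <= n%:R :> F by [].
have k0 : 0 <= k%:R :> F by [].
rewrite !apery_cS; set y := apery_c n k in IH *; set x := apery_c n.+1 k in IH *.
have -> : x = y + (x - y) by ring.
rewrite IH pair_diag pair_succ (exprS (-1)) -!natr1.
clearbody x y; move: t0 ((-1) ^+ k) => {IH} t0 sg; field.
by rewrite !natr_add1_neq0 t0 nk0 /= andbT; apply/andP; split; apply: lt0r_neq0; lra.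
Qed.

(** Multiplying by the square of t(n,k+1) extends the row difference past the end of the row, where
    both sides vanish. *)
Lemma pair_c_below n k :
  t n k.+1 ^+ 2 * (apery_c n.+1 k - apery_c n k) =
  (-1) ^+ k * t n k.+1 * (n%:R - k%:R) / ((k%:R + 1) ^+ 2 * (n%:R + 1) ^+ 2).
Proof.
case: (leqP k n) => [lekn|ltnk]; last first.
  by rewrite (binomial_pair_small (ltnW _)) ?ltnS // expr0n !(mul0r, mulr0).
have n0 : 0 <= n%:R :> F by [].
have k0 : 0 <= k%:R :> F by [].
have a1 : n%:R + 1 + k%:R != 0 :> F by apply: lt0r_neq0; lra.
rewrite (apery_c_row lekn) pair_succ; field.
by rewrite !natr_add1_neq0 a1 pair_neq0.
Qed.

Lemma pair_c_step n k :
  t n k.+1 ^+ 2 * ((-1) ^+ k / (2 * k.+1%:R ^+ 3 * t n k.+1)) =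
  (-1) ^+ k * t n k.+1 / (2 * (k%:R + 1) ^+ 3).
Proof.
rewrite -natr1; have [->|s0] := eqVneq (t n k.+1) 0.
  by rewrite expr0n !(mul0r, mulr0).
by field; rewrite natr_add1_neq0 s0.
Qed.

Definition apery_c_cert n k : F :=
  apery_cert n k * t n k ^+ 2 * apery_c n k
  - 5 * (2 * n%:R + 1) * (-1) ^+ k * k%:R * t n k / (n%:R * (n%:R + 1)).

Lemma apery_c_cert_telescope n k : (k <= n.+1)%N ->
  apery_op (fun m j => t m j ^+ 2 * apery_c m j) n k.+1 =
  apery_c_cert n.+1 k.+1 - apery_c_cert n.+1 k.
Proof.
move=> lekn; set C := apery_c n.+1 k.
have s0 := pair_neq0 lekn.
have n0 : 0 <= n%:R :> F by [].
have k0 : 0 <= k%:R :> F by [].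
have a1 : n%:R + 1 + 1 + k%:R != 0 :> F by apply: lt0r_neq0; lra.
(* The three values of [apery_c] are expanded around the common value [C]. The terms in [C] cancel
   as in [apery_cert_telescope]; the rest is a rational identity times the sign and t(n+1,k). *)
have e0 : t n k.+1 ^+ 2 * apery_c n k.+1 = t n k.+1 ^+ 2 * C
    - (-1) ^+ k * t n k.+1 * (n%:R - k%:R) / ((k%:R + 1) ^+ 2 * (n%:R + 1) ^+ 2)
    + (-1) ^+ k * t n k.+1 / (2 * (k%:R + 1) ^+ 3).
  by rewrite -pair_c_below -pair_c_step apery_cS -/C; ring.
have e1 : t n.+1 k.+1 ^+ 2 * apery_c n.+1 k.+1 = t n.+1 k.+1 ^+ 2 * C
    + (-1) ^+ k * t n.+1 k.+1 / (2 * (k%:R + 1) ^+ 3).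
  by rewrite -pair_c_step apery_cS -/C; ring.
have e2 : t n.+2 k.+1 ^+ 2 * apery_c n.+2 k.+1 = t n.+2 k.+1 ^+ 2 * C
    + t n.+2 k.+1 ^+ 2
      * ((-1) ^+ k / ((n.+1%:R + 1) ^+ 2 * (n.+1%:R + 1 + k%:R) * t n.+1 k))
    + (-1) ^+ k * t n.+2 k.+1 / (2 * (k%:R + 1) ^+ 3).
  by rewrite -apery_c_row // -pair_c_step apery_cS -/C; ring.
rewrite /apery_c_cert -[apery_cert _ _ * _ * _]mulrA e1 /apery_op e0 e1 e2 -/C.
rewrite (exprS (-1)) /apery_cert /apery_coef (pair_diag n.+1) (pair_below n) (pair_succ n.+1).
rewrite -!natr1; move: s0 ((-1) ^+ k) => {e0 e1 e2} s0 sg; field.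
rewrite !natr_add1_neq0 s0 a1 /= andbT; apply: lt0r_neq0; lra.
Qed.

(** Terms beyond a row vanish, so the three sums can be taken over the longest range and the
    operator moved inside. *)
Lemma apery_op_sum w n : (forall m k, (m < k)%N -> w m k = 0) ->
  (n%:R + 2) ^+ 3 * (\sum_(k < n.+3) w n.+2 k)
  - apery_coef n.+1 * (\sum_(k < n.+2) w n.+1 k)
  + (n%:R + 1) ^+ 3 * (\sum_(k < n.+1) w n k) = \sum_(k < n.+3) apery_op w n k.
Proof.
move=> w0; have widen m d : \sum_(k < m.+1) w m k = \sum_(k < m.+1 + d) w m k.
  rewrite big_split_ord /= [X in _ + X]big1 ?addr0 // => i _.
  by rewrite w0 //; exact: leq_addr.
rewrite (widen n.+1 1%N) (widen n 2) addn1 addn2 /apery_op.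
by rewrite big_split sumrB -!mulr_sumr.
Qed.

Definition apery_a n : F := (apery_A n)%:R.
Definition apery_b n : F := \sum_(k < n.+1) t n k ^+ 2 * apery_c n k.

Lemma apery_aE n : apery_a n = \sum_(k < n.+1) t n k ^+ 2.
Proof.
rewrite /apery_a /apery_A natr_sum; apply: eq_bigr => k _.
by rewrite /binomial_pair -expnMn natrX.
Qed.

Lemma apery_a_rec : apery_rec apery_a.
Proof.
move=> n; rewrite !apery_aE (apery_op_sum (w := fun m j => t m j ^+ 2)); last first.
  by move=> m k ltmk; rewrite binomial_pair_small ?expr0n.
rewrite big_ord_recl (eq_bigr (fun k : 'I_n.+2 =>
    apery_cert n.+1 k.+1 * t n.+1 k.+1 ^+ 2 - apery_cert n.+1 k * t n.+1 k ^+ 2)); last first.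
  by move=> k _; exact: apery_cert_telescope.
rewrite -(big_mkord xpredT (fun k => apery_cert n.+1 k.+1 * t n.+1 k.+1 ^+ 2
  - apery_cert n.+1 k * t n.+1 k ^+ 2)).
(* The upper boundary term contains t(n+1,n+2) = 0, and the lower one cancels the summand of column
   0. *)
rewrite (telescope_sumr (fun k => apery_cert n.+1 k * t n.+1 k ^+ 2)) //.
rewrite (binomial_pair_small (ltnSn _)) /apery_op !binomial_pair0 /apery_cert.
by rewrite /apery_coef -[n.+1%:R]natr1; ring.
Qed.

Lemma apery_b_rec : apery_rec apery_b.
Proof.
move=> n; rewrite /apery_b (apery_op_sum (w := fun m j => t m j ^+ 2 * apery_c m j));
  last by move=> m k ltmk; rewrite binomial_pair_small ?expr0n ?mul0r.
rewrite big_ord_recl (eq_bigr (fun k : 'I_n.+2 =>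
    apery_c_cert n.+1 k.+1 - apery_c_cert n.+1 k)); last first.
  by move=> k _; apply: apery_c_cert_telescope; rewrite -ltnS.
rewrite -(big_mkord xpredT (fun k => apery_c_cert n.+1 k.+1 - apery_c_cert n.+1 k)).
rewrite (telescope_sumr (apery_c_cert n.+1)) //.
rewrite /apery_op /apery_c_cert (binomial_pair_small (ltnSn _)) !binomial_pair0.
have nz := natr_add1_neq0.
have n0 : 0 <= n%:R :> F by [].
have nz2 : n%:R + 2 != 0 :> F by apply: lt0r_neq0; lra.
(* In column 0 the values of [apery_c] are partial sums of inverse cubes. The leading coefficients
   turn the two added cubes into +1 and -1, which cancel. *)
have -> : apery_c n.+2 0 = apery_c n.+1 0 + (n%:R + 2) ^- 3.
  rewrite /apery_c !big_ord0 !addr0 big_ord_recr /=.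
  by congr (_ + _ ^- 3); rewrite -!natr1; ring.
have -> : apery_c n.+1 0 = apery_c n 0 + (n%:R + 1) ^- 3.
  by rewrite /apery_c !big_ord0 !addr0 big_ord_recr natr1.
rewrite /apery_cert /apery_coef -[n.+1%:R]natr1 expr0n /= !(mulr0, mul0r, subr0).
by field; rewrite nz nz2.
Qed.

Lemma apery_a_gt0 n : 0 < apery_a n.
Proof.
rewrite apery_aE big_ord_recl binomial_pair0 expr1n ltr_pwDl //.
by apply: sumr_ge0 => k _; exact: sqr_ge0.
Qed.

Lemma apery_a0 : apery_a 0 = 1.
Proof. by rewrite apery_aE big_ord1 binomial_pair0 expr1n. Qed.

Lemma apery_a1 : apery_a 1 = 5.
Proof.
rewrite apery_aE !big_ord_recr big_ord0 /=.
by have [-> ->] : binomial_pair 1 0 = 1%N /\ binomial_pair 1 1 = 2%N by []; ring.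
Qed.

Lemma apery_b0 : apery_b 0 = 0.
Proof. by rewrite /apery_b big_ord1 /apery_c !big_ord0 addr0 mulr0. Qed.

Lemma apery_b1 : apery_b 1 = 6.
Proof.
rewrite /apery_b !big_ord_recr !big_ord0 /apery_c !big_ord_recr !big_ord0 /=.
by have [-> ->] : binomial_pair 1 0 = 1%N /\ binomial_pair 1 1 = 2%N by []; field.
Qed.

(** The recurrence makes (n+1)^3 times the Casoratian constant; at n = 0 it equals 6 * 1 - 5 * 0 =
    6. *)
Lemma apery_casoratian n :
  apery_b n.+1 * apery_a n - apery_a n.+1 * apery_b n = 6 / (n%:R + 1) ^+ 3.
Proof.
elim: n => [|n IH]; first by rewrite apery_a0 apery_a1 apery_b0 apery_b1; field.
have nz := natr_add1_neq0 n.
have nz2 := natr_add1_neq0 n.+1.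
apply: (mulfI (expf_neq0 3 nz2)).
rewrite mulrCA divff ?expf_neq0 // mulr1.
have <- : (n%:R + 1) ^+ 3 * (6 / (n%:R + 1) ^+ 3) = 6 :> F.
  by rewrite mulrCA divff ?expf_neq0 // mulr1.
rewrite -IH.
rewrite -[n.+1%:R]natr1 -(addrA _ 1 1).
have := apery_a_rec n; have := apery_b_rec n.
set a2 := apery_a n.+2; set b2 := apery_b n.+2.
set P := apery_coef _; set X := (_ + _) ^+ 3; set Y := (_ + _) ^+ 3 => eb ea.
have -> : X * (b2 * apery_a n.+1 - a2 * apery_b n.+1) =
  (X * b2) * apery_a n.+1 - (X * a2) * apery_b n.+1 by ring.
have -> : X * b2 = P * apery_b n.+1 - Y * apery_b n by apply/eqP; rewrite -subr_eq0 -eb; apply/eqP; ring.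
have -> : X * a2 = P * apery_a n.+1 - Y * apery_a n by apply/eqP; rewrite -subr_eq0 -ea; apply/eqP; ring.
ring.
Qed.

End Certificates.

(** * The least common multiple of 1, ..., n *)

Definition lcm_upto (n : nat) : nat := \big[lcmn/1%N]_(i < n) i.+1.

Lemma lcm_uptoS (n : nat) : lcm_upto n.+1 = lcmn (lcm_upto n) n.+1.
Proof. by rewrite /lcm_upto big_ord_recr. Qed.

Lemma lcm_upto_gt0 (n : nat) : (0 < lcm_upto n)%N.
Proof. by elim: n => [|n IH]; rewrite ?lcm_uptoS ?lcmn_gt0 ?IH // /lcm_upto big_ord0. Qed.

Lemma dvdn_lcm_upto (m n : nat) : (0 < m <= n)%N -> (m %| lcm_upto n)%N.
Proof. by case: m => // m ltmn; apply: (biglcmn_sup (Ordinal ltmn)). Qed.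

Lemma lcm_upto_dvd (m n : nat) : (m <= n)%N -> (lcm_upto m %| lcm_upto n)%N.
Proof.
move=> lemn; apply/dvdn_biglcmP => i _; apply: dvdn_lcm_upto.
exact: leq_trans (ltn_ord i) lemn.
Qed.

Lemma logn_lcm_upto_le (p n : nat) : prime p ->
  (logn p (lcm_upto n) <= trunc_log p n)%N.
Proof.
move=> pp; elim: n => [|n IH]; first by rewrite /lcm_upto big_ord0 logn1.
rewrite lcm_uptoS logn_lcm ?lcm_upto_gt0 // geq_max.
rewrite (leq_trans IH) ?leq_trunc_log //=.
by rewrite trunc_log_max ?prime_gt1 // dvdn_leq // pfactor_dvdnn.
Qed.

Lemma logn_lcm_upto_ge (p n : nat) : prime p ->
  (trunc_log p n <= logn p (lcm_upto n))%N.
Proof.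
move=> pp; case: (posnP n) => [->|n0]; first by rewrite trunc_log0.
rewrite -pfactor_dvdn ?lcm_upto_gt0 // dvdn_lcm_upto //.
by rewrite expn_gt0 prime_gt0 //= trunc_logP ?prime_gt1.
Qed.

(** The exponent of p in lcm(1..n) is [trunc_log p n]. Counting the powers of p up to n gives it the
    shape of Legendre's formula, so that it can be compared with factorials term by term. *)
Lemma trunc_logE (p n : nat) : prime p ->
  trunc_log p n = (\sum_(1 <= k < n.+1) (p ^ k <= n))%N.
Proof.
move=> pp; have p1 := prime_gt1 pp.
have lt_n : (trunc_log p n <= n)%N.
  case: (posnP n) => [->|n0]; first by rewrite trunc_log0.
  exact: leq_trans (ltnW (ltn_expl _ p1)) (trunc_logP p1 n0).
rewrite (big_cat_nat _ (n := (trunc_log p n).+1)) //= big_nat_cond.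
rewrite (eq_bigr (fun=> 1%N)); last first.
  move=> k /andP[/andP[k0 lek] _]; case: (posnP n) => [n0|n0].
    by move: lek; rewrite n0 trunc_log0 ltnS leqNgt k0.
  by rewrite (leq_trans _ (trunc_logP p1 n0)) // leq_exp2l.
rewrite -big_nat_cond sum_nat_const_nat subn1 muln1 big_nat_cond big1 ?addn0 //.
move=> k /andP[/andP[ltk _] _]; apply/eqP; rewrite eqb0 -ltnNge.
by rewrite (leq_trans (trunc_log_ltn n p1)) // leq_exp2l.
Qed.

(* 1/2 + 1/3 + 1/7 = 41/42, so for 0 < x < 42 the floors of x/2, x/3 and x/7
   add up to at most x - 1. *)
Lemma lcm_upto_fact_dvd (n : nat) :
  (lcm_upto n * ((n %/ 2)`! * (n %/ 3)`! * (n %/ 7)`! * (n %/ 42)`!)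
     %| lcm_upto (n %/ 42) * n`!)%N.
Proof.
have l0 := lcm_upto_gt0; have f0 := fact_gt0.
apply/dvdn_partP => [|p]; first by rewrite !muln_gt0 !l0 !f0.
rewrite mem_primes => /andP[pp _]; rewrite p_part pfactor_dvdn ?muln_gt0 ?l0 ?f0 //.
rewrite !lognM ?muln_gt0 ?l0 ?f0 //.
rewrite (leq_trans (leq_add (logn_lcm_upto_le n pp) (leqnn _))) //.
rewrite (leq_trans _ (leq_add (logn_lcm_upto_ge (n %/ 42) pp) (leqnn _))) //.
have widen (m : nat) (F : nat -> nat) : (m <= n)%N -> (forall k, m < k -> F k = 0)%N ->
    (\sum_(1 <= k < m.+1) F k = \sum_(1 <= k < n.+1) F k)%N.
  move=> lemn F0; rewrite [RHS](big_cat_nat _ (n := m.+1)) //=.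
  rewrite [X in (_ + X)%N]big_nat_cond [X in (_ + X)%N]big1 ?addn0 //.
  by move=> k /andP[/andP[ltmk _] _]; exact: F0.
have ltpk (k : nat) : (k < p ^ k)%N by rewrite ltn_expl ?prime_gt1.
have lefact (m : nat) : logn p (n %/ m)`! = (\sum_(1 <= k < n.+1) (n %/ p ^ k) %/ m)%N.
  rewrite logn_fact // (widen (n %/ m)%N) ?leq_div //.
    by apply: eq_bigr => k _; rewrite -!divnMA mulnC.
  by move=> k ltk; rewrite divn_small // (ltn_trans ltk).
rewrite !lefact logn_fact // !trunc_logE // (widen (n %/ 42)%N) ?leq_div //; last first.
  by move=> k ltk; apply/eqP; rewrite eqb0 -ltnNge (ltn_trans ltk).
rewrite -!big_split /=; apply: leq_sum => k _.
have pk0 : (0 < p ^ k)%N by rewrite expn_gt0 prime_gt0.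
have -> : (p ^ k <= n)%N = (0 < n %/ p ^ k)%N by rewrite divn_gt0.
have -> : (p ^ k <= n %/ 42)%N = (42 <= n %/ p ^ k)%N.
  by rewrite !leq_divRL // mulnC.
(* It remains to see, with floors, that [x > 0] + x/2 + x/3 + x/7 + x/42 <= [x >= 42] + x. From 42
   on this follows from 1/2 + 1/3 + 1/7 + 1/42 = 1. *)
set x := (n %/ p ^ k)%N; case: (ltnP 0 x); case: (leqP 42 x) => /=; lia.
Qed.

Lemma leq_expl (m n k : nat) : (m <= n)%N -> (m ^ k <= n ^ k)%N.
Proof. by case: k => // k lemn; rewrite leq_exp2r. Qed.

Lemma bin_mul_expn_le (x y a b : nat) :
  ('C(a + b, a) * (x ^ a * y ^ b) <= (x + y) ^ (a + b))%N.
Proof.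
have lta : (b < (a + b).+1)%N by rewrite ltnS leq_addl.
rewrite expnDn (bigD1 (Ordinal lta)) //= addnK.
by rewrite -[X in 'C(_, X)](addnK b a) bin_sub ?leq_addl // leq_addr.
Qed.

(** A multinomial coefficient times a product of weights of sum 1 is at most 1; the weights are 1/2,
    1/3, 1/7, 1/42. Splitting off one class at a time gives three binomials, with odds 1:1, 2:1 and
    6:1. *)
Lemma fact_multinomial_le (a b c e : nat) :
  ((a + b + c + e)`! <= a`! * b`! * c`! * e`! * (2 ^ a * 3 ^ b * 7 ^ c * 42 ^ e))%N.
Proof.
have factD (m n : nat) : ((m + n)`! = 'C(m + n, m) * (m`! * n`!))%N.
  by rewrite -(bin_fact (leq_addr n m)) addKn.
have h1 := bin_mul_expn_le 1 1 a (b + (c + e)).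
have h2 := bin_mul_expn_le 2 1 b (c + e).
have h3 := bin_mul_expn_le 6 1 c e.
rewrite -!addnA !factD.
set C1 := 'C(_, a) in h1 *; set C2 := 'C(_, b) in h2 *; set C3 := 'C(_, c) in h3 *.
have -> : (C1 * (a`! * (C2 * (b`! * (C3 * (c`! * e`!))))) =
  a`! * b`! * c`! * e`! * (C1 * C2 * C3))%N by ring.
apply: leq_mul => //; rewrite -(@leq_pmul2r (2 ^ b * 6 ^ c)) ?muln_gt0 ?expn_gt0 //.
have -> : (C1 * C2 * C3 * (2 ^ b * 6 ^ c) =
  C1 * (1 ^ a * 1 ^ (b + (c + e))) * (C2 * (2 ^ b * 1 ^ (c + e)))
  * (C3 * (6 ^ c * 1 ^ e)))%N by rewrite !exp1n; ring.
apply: leq_trans (leq_mul (leq_mul h1 h2) h3) _.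
have -> : 42%N = (2 * 3 * 7)%N by [].
have -> : 6%N = (2 * 3)%N by [].
by rewrite !expnMn -!expnMn !expnD; apply: eq_leq; rewrite !expnMn; ring.
Qed.

Lemma fact_ratio_le (m r : nat) : ((m + r)`! <= m`! * (m + r) ^ r)%N.
Proof.
elim: r => [|r IH]; first by rewrite addn0 muln1.
rewrite addnS factS expnS mulnCA leq_mul // (leq_trans IH) // leq_mul //.
by rewrite leq_expl.
Qed.

(* The exponent 42 clears the denominators of n/2, n/3, n/7 and n/42. *)
Lemma lcm_upto_step (n : nat) : (0 < n)%N ->
  (lcm_upto n ^ 42 <=
   lcm_upto (n %/ 42) ^ 42 * n ^ 126 * (2 ^ 21 * 3 ^ 14 * 7 ^ 6 * 42) ^ n)%N.
Proof.
move=> n0.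
set a := (n %/ 2)%N; set b := (n %/ 3)%N; set c := (n %/ 7)%N; set e := (n %/ 42)%N.
have f0 := fact_gt0.
have ds : (lcm_upto n <= lcm_upto e * n ^ 3 * (2 ^ a * 3 ^ b * 7 ^ c * 42 ^ e))%N.
  rewrite -(@leq_pmul2r (a`! * b`! * c`! * e`!)) ?muln_gt0 ?f0 //.
  have := dvdn_leq _ (lcm_upto_fact_dvd n); rewrite muln_gt0 lcm_upto_gt0 f0 => /(_ isT).
  move=> /leq_trans; apply; rewrite -/e -2!mulnA leq_mul //.
  (* The fractional parts of n/2, n/3, n/7 and n/42 add up to at most 1/2 + 2/3 + 6/7 + 41/42 = 3,
     whence the factor n^3. *)
  have [r lter en] : exists2 r, (r <= 3)%N & n = (a + b + c + e + r)%N.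
    by exists (n - (a + b + c + e))%N; rewrite /a /b /c /e; lia.
  have : (n`! <= (a + b + c + e)`! * n ^ r)%N by rewrite {1 2}en fact_ratio_le.
  move=> /leq_trans; apply; rewrite mulnC leq_mul ?leq_pexp2l //.
  by apply: leq_trans (fact_multinomial_le _ _ _ _) _; rewrite mulnC.
have : (lcm_upto n ^ 42 <= (lcm_upto e * n ^ 3 * (2 ^ a * 3 ^ b * 7 ^ c * 42 ^ e)) ^ 42)%N.
  by rewrite leq_exp2r.
move=> /leq_trans; apply.
rewrite !(expnMn _ _ 42) -!expnM leq_mul //; first by rewrite -!expnD.
have -> x y z w : ((x ^ 21 * y ^ 14 * z ^ 6 * w) ^ n =
    x ^ (21 * n) * y ^ (14 * n) * z ^ (6 * n) * w ^ n)%N.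
  by rewrite 3!expnMn -!expnM.
by rewrite !leq_mul ?leq_pexp2l // /a /b /c /e; lia.
Qed.

(** With m the floor of n/256, n <= 2^(8+m), and 126(8+m) <= 256m as soon as m >= 8, that is n >=
    2048. *)
Lemma expn_126_le (n : nat) : (2048 <= n)%N -> (n ^ 126 <= 2 ^ n)%N.
Proof.
move=> len; set m := (n %/ 256)%N.
have ltn : (n <= 2 ^ (8 + m))%N.
  rewrite expnD; apply: (@leq_trans (256 * m.+1)); first by rewrite /m; lia.
  by rewrite leq_mul // ltn_expl.
apply: (@leq_trans ((2 ^ (8 + m)) ^ 126)); first by rewrite leq_exp2r.
by rewrite -expnM leq_pexp2l // /m; lia.
Qed.

(** Applied at 2, 3, 7, where 3^5 <= 2^8 and 7 <= 2^3, this bounds the constant of [lcm_upto_step]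
    by 2^67. With variables the large powers are never evaluated. *)
Lemma lcm_upto_constant_le (x y z : nat) : (y ^ 5 <= x ^ 8)%N -> (z <= x ^ 3)%N ->
  (x ^ 21 * y ^ 14 * z ^ 6 * (x * y * z) <= x ^ 67)%N.
Proof.
move=> hy hz.
have -> : (x ^ 67 = x ^ 22 * (x ^ 8) ^ 3 * (x ^ 3) ^ 7)%N by ring.
have -> : (x ^ 21 * y ^ 14 * z ^ 6 * (x * y * z) = x ^ 22 * (y ^ 5) ^ 3 * z ^ 7)%N by ring.
exact: leq_mul (leq_mul (leqnn _) (leq_expl 3 hy)) (leq_expl 7 hz).
Qed.

Lemma lcm_upto_cube_le : exists K : nat, forall n, (lcm_upto n ^ 3 <= K * 32 ^ n)%N.
Proof.
have [K K0 base] : exists2 K, (0 < K)%N &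
    forall n, (n <= 2048)%N -> (lcm_upto n ^ 42 <= K)%N.
  exists (lcm_upto 2048 ^ 42)%N => [|n len]; first by rewrite expn_gt0 lcm_upto_gt0.
  by apply: leq_expl; rewrite dvdn_leq ?lcm_upto_gt0 // lcm_upto_dvd.
(* The exponent 70 closes the induction, as 70(n/42) + n + 67n <= 70n, and 70 = 14 * 5 yields 32 =
   2^5 after a 14th root. *)
have main n : (lcm_upto n ^ 42 <= K * 2 ^ (70 * n))%N.
  elim/ltn_ind: n => n IH; have [len|ltn] := leqP n 2048.
    by apply: leq_trans (base _ len) _; rewrite leq_pmulr ?expn_gt0.
  have n0 : (0 < n)%N by apply: leq_ltn_trans ltn.
  apply: leq_trans (lcm_upto_step n0) _.
  have lt_e : (n %/ 42 < n)%N by lia.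
  apply: leq_trans (leq_mul (leq_mul (IH _ lt_e) (expn_126_le (ltnW ltn)))
    (leq_expl n (@lcm_upto_constant_le 2 3 7 isT isT))) _.
  rewrite -expnM -!mulnA -!expnD; apply: leq_mul (leqnn _) _.
  by apply: leq_pexp2l => //; lia.
exists K => n; rewrite -(@leq_exp2r _ _ 14) // -expnM expnMn -expnM.
apply: leq_trans (main n) _; apply: leq_mul.
  by rewrite -[K in (K <= _)%N]expn1; apply: leq_pexp2l.
have -> : (32 = 2 ^ 5)%N by [].
by rewrite -expnM; apply: leq_pexp2l => //; lia.
Qed.

(** * Integrality of 2 lcm(1..n)^3 B_n *)

Section Integrality.
Context {F : archiRealFieldType}.
Implicit Types n k m N : nat.

Lemma int_divn_nat m n : (m %| n)%N -> (n%:R / m%:R : F) \is a Num.int.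
Proof.
case/dvdnP => q ->; have [->|m0] := posnP m; first by rewrite invr0 mulr0.
by rewrite natrM mulfK ?pnatr_eq0 -?lt0n // Num.Theory.natr_int.
Qed.

(* The reciprocals of k C(n, k) form Leibniz's harmonic triangle: each one is
   a difference of two neighbours in the preceding column. *)
Lemma int_lcm_upto_bin N n k : (0 < k <= n)%N -> (n <= N)%N ->
  ((lcm_upto N)%:R / (k%:R * 'C(n, k)%:R) : F) \is a Num.int.
Proof.
case: k => // k /andP[_]; elim: k n => [|k IH] [|n] // ltkn lenN.
  by rewrite bin1 mul1r int_divn_nat // dvdn_lcm_upto.
have ltkn' : (k < n)%N by [].
have -> : (lcm_upto N)%:R / (k.+2%:R * 'C(n.+1, k.+2)%:R) =
    (lcm_upto N)%:R / (k.+1%:R * 'C(n, k.+1)%:R)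
    - (lcm_upto N)%:R / (k.+1%:R * 'C(n.+1, k.+1)%:R) :> F.
  have e1 : k.+2%:R * 'C(n.+1, k.+2)%:R = (n%:R + 1) * 'C(n, k.+1)%:R :> F.
    by rewrite -natrM -mul_bin_diag natrM -natr1.
  have e2 : (n%:R - k%:R) * 'C(n.+1, k.+1)%:R = (n%:R + 1) * 'C(n, k.+1)%:R :> F.
    by rewrite -natrB 1?ltnW // -natrM -[(n - k)%N]subSS -mul_bin_down natrM -natr1.
  have C0 : 'C(n, k.+1)%:R != 0 :> F by rewrite pnatr_eq0 -lt0n bin_gt0.
  have nk0 : n%:R - k%:R != 0 :> F by rewrite subr_eq0 eqr_nat gtn_eqF.
  have n1 := @natr_add1_neq0 F n; have k1 := @natr_add1_neq0 F k.
  rewrite e1 -(mulKf nk0 'C(n.+1, k.+1)%:R) e2 -[k.+1%:R]natr1; field.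
  by rewrite n1 k1 C0 nk0.
by rewrite rpredB ?IH // ltnW.
Qed.

(** Since C(n+k,k) / C(n+m,m) = C(n+k,k-m) / C(k,m), the denominator becomes the product of m, m
    C(n,m) and m C(k,m), and each is absorbed by one factor lcm(1..N). *)
Lemma int_lcm_upto_pair N n k m : (0 < m <= k)%N -> (k <= n)%N -> (n <= N)%N ->
  ((lcm_upto N)%:R ^+ 3 * (binomial_pair n k)%:R
     / (m%:R ^+ 3 * (binomial_pair n m)%:R) : F) \is a Num.int.
Proof.
move=> /andP[m0 lemk] lekn lenN.
have e : ('C(n + k, k) * 'C(k, m) = 'C(n + k, k - m) * 'C(n + m, m))%N.
  have [j ->] : exists j, k = (m + j)%N by exists (k - m)%N; rewrite subnKC.
  have f1 := bin_fact (leq_addl n (m + j)); rewrite addnK in f1.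
  have f2 := bin_fact (leq_addr j m); rewrite addKn in f2.
  have f3 := bin_fact (leq_addl (n + m) j); rewrite addnK -addnA in f3.
  have f4 := bin_fact (leq_addl n m); rewrite addnK in f4.
  apply/eqP; rewrite addKn -(@eqn_pmul2r (m`! * j`! * n`!)) ?muln_gt0 ?fact_gt0 //.
  rewrite mulnACA; apply/eqP; transitivity (n + (m + j))`!.
    by rewrite -f1 -f2; ring.
  by rewrite -f3 -f4; ring.
have c1 : 'C(n, m)%:R != 0 :> F by rewrite pnatr_eq0 -lt0n bin_gt0 (leq_trans lemk).
have c2 : 'C(k, m)%:R != 0 :> F by rewrite pnatr_eq0 -lt0n bin_gt0.
have c3 : 'C(n + m, m)%:R != 0 :> F by rewrite pnatr_eq0 -lt0n bin_gt0 leq_addl.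
have m1 : m%:R != 0 :> F by rewrite pnatr_eq0 -lt0n.
have -> : (lcm_upto N)%:R ^+ 3 * (binomial_pair n k)%:R
     / (m%:R ^+ 3 * (binomial_pair n m)%:R) =
   'C(n, k)%:R * 'C(n + k, k - m)%:R * ((lcm_upto N)%:R / m%:R)
   * ((lcm_upto N)%:R / (m%:R * 'C(n, m)%:R))
   * ((lcm_upto N)%:R / (m%:R * 'C(k, m)%:R)) :> F.
  move/(congr1 (fun i => i%:R : F)): e; rewrite /binomial_pair !natrM => e.
  rewrite -(mulfK c2 'C(n + k, k)%:R) e; field.
  by rewrite c1 c2 c3 m1.
apply: rpredM; last by rewrite int_lcm_upto_bin ?m0 // (leq_trans lekn).
apply: rpredM; last by rewrite int_lcm_upto_bin // m0 (leq_trans lemk).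
apply: rpredM; first by rewrite rpredM ?Num.Theory.natr_int.
by rewrite int_divn_nat // dvdn_lcm_upto // m0 (leq_trans lemk) // (leq_trans lekn).
Qed.

(** The 2 cancels the one in the alternating part of [apery_c], where one of the two factors t(n,k)
    helps to clear the denominator t(n,i+1). *)
Lemma int_lcm_upto_apery_b n :
  (2 * (lcm_upto n)%:R ^+ 3 * apery_b n : F) \is a Num.int.
Proof.
rewrite /apery_b mulr_sumr rpred_sum // => k _.
have lekn : (k <= n)%N by rewrite -ltnS.
rewrite /apery_c mulrDr mulrDr rpredD //.
  rewrite !mulr_sumr rpred_sum // => i _.
  have -> : 2 * (lcm_upto n)%:R ^+ 3 * ((binomial_pair n k)%:R ^+ 2 * i.+1%:R ^- 3) =
    2 * (binomial_pair n k)%:R ^+ 2 * ((lcm_upto n)%:R / i.+1%:R) ^+ 3 :> F.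
    by field; rewrite nat1r pnatr_eq0.
  apply: rpredM; first by rewrite rpredM ?rpredX ?Num.Theory.natr_int.
  by apply: rpredX; apply: int_divn_nat; apply: dvdn_lcm_upto; rewrite /= ltn_ord.
rewrite !mulr_sumr rpred_sum // => i _.
have lein : (i.+1 <= n)%N := leq_trans (ltn_ord i) lekn.
have -> : 2 * (lcm_upto n)%:R ^+ 3 * ((binomial_pair n k)%:R ^+ 2
      * ((-1) ^+ i / (2 * i.+1%:R ^+ 3 * (binomial_pair n i.+1)%:R))) =
    (-1) ^+ i * (binomial_pair n k)%:R * ((lcm_upto n)%:R ^+ 3 * (binomial_pair n k)%:R
     / (i.+1%:R ^+ 3 * (binomial_pair n i.+1)%:R)) :> F.
  by field; rewrite pair_neq0 // nat1r pnatr_eq0.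
apply: rpredM; last by apply: int_lcm_upto_pair => //=; exact: ltn_ord.
by apply: rpredM; rewrite ?Num.Theory.natr_int // rpredX // rpredN rpred1.
Qed.

End Integrality.

(** * Growth of A_n and irrationality *)

Section Growth.
Context {F : realFieldType}.
Implicit Types n k m : nat.
Local Notation a := (@apery_a F).
Local Notation b := (@apery_b F).

(** The recurrence with its term in A_n dropped: the middle coefficient is at most 34(n+2)^3. *)
Lemma apery_a_upper n : a n.+1 <= 34 * a n.
Proof.
case: n => [|n]; first by rewrite apery_a0 apery_a1; lra.
have := apery_a_rec (F := F) n; have := apery_a_gt0 (F := F).
rewrite /apery_coef -[n.+1%:R]natr1 => a_gt0.
have := ler0n F n; move: (n%:R : F) => x x0.
move: (a n.+2) (a n.+1) (a n) (a_gt0 n.+1) (a_gt0 n) => a2 a1 a0 a1_gt0 a0_gt0 e.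
have x2 : 0 < (x + 2) ^+ 3 by rewrite exprn_gt0 //; lra.
rewrite -(ler_pM2l x2) -subr_ge0.
have -> : (x + 2) ^+ 3 * (34 * a1) - (x + 2) ^+ 3 * a2 =
  (34 * (x + 2) ^+ 3 - (34 * (x + 1) ^+ 3 + 51 * (x + 1) ^+ 2 + 27 * (x + 1) + 5)) * a1
  + (x + 1) ^+ 3 * a0.
  by apply/eqP; rewrite -subr_eq0 -oppr_eq0; apply/eqP; rewrite -e; ring.
have -> : 34 * (x + 2) ^+ 3 - (34 * (x + 1) ^+ 3 + 51 * (x + 1) ^+ 2 + 27 * (x + 1) + 5) =
  51 * x ^+ 2 + 177 * x + 155 :> F by ring.
by rewrite addr_ge0 // mulr_ge0 ?exprn_ge0 ?(ltW a1_gt0) ?(ltW a0_gt0) //; nra.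
Qed.

(** The recurrence turns a lower bound c on one quotient of consecutive terms into a lower bound d
    on the next. *)
Lemma apery_a_lower_step (c d : F) n : 0 < c ->
  c * a n <= a n.+1 ->
  d * (n%:R + 2) ^+ 3 <= apery_coef n.+1 - (n%:R + 1) ^+ 3 / c ->
  d * a n.+1 <= a n.+2.
Proof.
move=> c0 le1 le2; have := apery_a_rec (F := F) n; have := apery_a_gt0 (F := F) n.+1.
have := ler0n F n; move: (n%:R : F) (apery_coef _) le2 => x P le2 x0.
move: (a n.+2) (a n.+1) (a n) le1 => a2 a1 a0 le1 a1_gt0 e.
have x2 : 0 < (x + 2) ^+ 3 by rewrite exprn_gt0 //; lra.
have x1 : 0 < (x + 1) ^+ 3 by rewrite exprn_gt0 //; lra.
rewrite -(ler_pM2l x2).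
have -> : (x + 2) ^+ 3 * a2 = P * a1 - (x + 1) ^+ 3 * a0.
  by apply/eqP; rewrite -subr_eq0 -e; apply/eqP; ring.
have le3 : (x + 1) ^+ 3 * a0 <= (x + 1) ^+ 3 / c * a1.
  rewrite -mulrA ler_wpM2l ?(ltW x1) // mulrC ler_pdivlMr // mulrC.
  exact: le1.
have := ler_wpM2r (ltW a1_gt0) le2; nra.
Qed.

Lemma apery_a_lower n : 5 * a n <= a n.+1.
Proof.
elim: n => [|n IH]; first by rewrite apery_a0 apery_a1 mulr1.
apply: (apery_a_lower_step _ IH) => //; rewrite /apery_coef -[n.+1%:R]natr1.
have := ler0n F n; move: (n%:R : F) => x x0; rewrite -subr_ge0.
have -> : 34 * (x + 1) ^+ 3 + 51 * (x + 1) ^+ 2 + 27 * (x + 1) + 5 - (x + 1) ^+ 3 / 5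
   - 5 * (x + 2) ^+ 3 = (29 - 5^-1) * x ^+ 3 + (123 - 3 / 5) * x ^+ 2 + (171 - 3 / 5) * x + 77 - 5^-1 :> F.
  by field.
have := exprn_ge0 3 x0; have := exprn_ge0 2 x0; nra.
Qed.

(** From the quotient bound 5 the next bound tends to 34 - 1/5 > 33, so 33 is reached for large
    n. *)
Lemma apery_a_lower33 n : (62 <= n)%N -> 33 * a n <= a n.+1.
Proof.
case: n => // n; rewrite ltnS => len.
apply: (apery_a_lower_step _ (apery_a_lower n)) => //; rewrite /apery_coef -[n.+1%:R]natr1.
have : 61%:R <= n%:R :> F by rewrite ler_nat.
move: (n%:R : F) => x x0; rewrite -subr_ge0.
(* Recentred at 61, the difference is a cubic with positive coefficients. *)
have [y y0 ->] : exists2 y, 0 <= y & x = y + 61 by exists (x - 61); lra.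
set e := (X in 0 <= X).
have -> : e = 4 / 5 * y ^+ 3 + 504 / 5 * y ^+ 2 + 16008%:R / 5 * y + 8292%:R / 5.
  by rewrite /e; field.
have := exprn_ge0 3 y0; have := exprn_ge0 2 y0; lra.
Qed.

Lemma apery_a_ge1 n : 1 <= a n.
Proof.
elim: n => [|n IH]; first by rewrite apery_a0.
by have := apery_a_lower n; lra.
Qed.

Definition apery_ratio n : F := b n / a n.

Lemma apery_ratioS n :
  apery_ratio n.+1 - apery_ratio n = 6 / ((n%:R + 1) ^+ 3 * (a n * a n.+1)).
Proof.
have a1 := lt0r_neq0 (apery_a_gt0 (F := F) n.+1).
have a0 := lt0r_neq0 (apery_a_gt0 (F := F) n).
have n1 := natr_add1_neq0 (F := F) n.
have -> : 6 / ((n%:R + 1) ^+ 3 * (a n * a n.+1)) = 6 / (n%:R + 1) ^+ 3 / (a n * a n.+1).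
  by field; rewrite n1 a0 a1.
by rewrite -apery_casoratian /apery_ratio; field; rewrite a0 a1.
Qed.

Lemma apery_ratio_lt n : apery_ratio n < apery_ratio n.+1.
Proof.
rewrite -subr_gt0 apery_ratioS; apply: divr_gt0 => //; apply: mulr_gt0.
  by rewrite natr1 exprn_gt0 ?ltr0n.
by apply: mulr_gt0; exact: apery_a_gt0.
Qed.

Lemma apery_ratio_mono m n : (m <= n)%N -> apery_ratio m <= apery_ratio n.
Proof.
move=> /subnKC <-; elim: (n - m)%N => [|k IH]; rewrite ?addn0 // addnS.
exact: le_trans IH (ltW (apery_ratio_lt _)).
Qed.

(** These are the decreasing upper ends of intervals whose lower ends are the increasing ratios. One
    step reduces to y^2 - xy - x^2 >= 0 for x = A_n, y = A_{n+1}, which follows from y >= 5x. *)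
Lemma apery_ratio_upper m n : (m <= n)%N ->
  apery_ratio n + 6 / a n ^+ 2 <= apery_ratio m + 6 / a m ^+ 2.
Proof.
move=> /subnKC <-; elim: (n - m)%N => [|k]; rewrite ?addn0 // addnS.
move: (m + k)%N => {n k} n; apply: le_trans.
have x0 := apery_a_gt0 (F := F) n; have y0 := apery_a_gt0 (F := F) n.+1.
have xy := apery_a_lower n.
have -> : apery_ratio n.+1 = apery_ratio n + (apery_ratio n.+1 - apery_ratio n) by ring.
rewrite apery_ratioS -addrA lerD2l.
apply: (@le_trans _ _ (6 / (a n * a n.+1) + 6 / a n.+1 ^+ 2)).
  have n1 : 1 <= (n%:R + 1) ^+ 3 :> F by rewrite exprn_ege1 // natr1 ler1n.
  have aa0 : 0 < a n * a n.+1 by rewrite mulr_gt0.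
  have n0 := lt_le_trans ltr01 n1.
  rewrite lerD2r ler_wpM2l // lef_pV2 ?posrE //; last by rewrite mulr_gt0.
  by rewrite ler_peMl // ltW.
move: (a n) (a n.+1) x0 y0 xy => x y x0 y0 xy.
rewrite -subr_ge0.
have -> : 6 / x ^+ 2 - (6 / (x * y) + 6 / y ^+ 2) = 6 * (y ^+ 2 - x * y - x ^+ 2) / (x * y) ^+ 2.
  by field; rewrite !lt0r_neq0.
by rewrite divr_ge0 ?sqr_ge0 // mulr_ge0 //; nra.
Qed.

(** Absorption gives m C(n,m) = n C(n-1,m-1) >= n and m C(n+m,m) = (n+m) C(n+m-1,m-1) >= n+1. *)
Lemma expn3_pair_ge n m : (0 < m <= n)%N ->
  (n * n.+1 <= m ^ 3 * binomial_pair n m)%N.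
Proof.
case: m => // m /andP[_]; case: n => // n; rewrite ltnS => lemn.
have e1 := mul_bin_diag n.+1 m; have e2 := mul_bin_diag (n.+1 + m).+1 m.
rewrite /= in e1 e2.
have C1 : (0 < 'C(n, m))%N by rewrite bin_gt0.
have C2 : (0 < 'C(n.+1 + m, m))%N by rewrite bin_gt0 leq_addl.
have -> : (m.+1 ^ 3 * binomial_pair n.+1 m.+1 =
   m.+1 * ((m.+1 * 'C(n.+1, m.+1)) * (m.+1 * 'C((n.+1 + m).+1, m.+1))))%N.
  by rewrite /binomial_pair addnS; ring.
rewrite -e1 -e2.
apply: (@leq_trans (1 * ((n.+1 * 1) * (n.+2 * 1)))); first by rewrite !mul1n !muln1.
rewrite leq_mul // leq_mul // leq_mul //; lia.
Qed.

Lemma apery_c_close n k : (k <= n)%N ->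
  `|apery_c n k - \sum_(i < n) i.+1%:R ^- 3| <= (n%:R + 1)^-1 :> F.
Proof.
move=> lekn; rewrite /apery_c addrAC subrr add0r.
apply: le_trans (ler_norm_sum _ _ _) _.
have [n0|n0] := posnP n.
  by move: lekn; rewrite n0 leqn0 => /eqP ->; rewrite big_ord0 invr_ge0 natr1.
apply: (@le_trans _ _ (\sum_(i < k) (n%:R * (n%:R + 1))^-1)).
  apply: ler_sum => i _.
  have lin : (0 < i.+1 <= n)%N by exact: leq_trans (ltn_ord i) lekn.
  have le1 : n%:R * (n%:R + 1) <= i.+1%:R ^+ 3 * (binomial_pair n i.+1)%:R :> F.
    by rewrite natr1 -natrX -!natrM ler_nat expn3_pair_ge.
  rewrite normrM normrX normrN normr1 expr1n mul1r normfV.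
  have t0 : 0 < (binomial_pair n i.+1)%:R :> F by rewrite ltr0n binomial_pair_gt0.
  have t1 : 0 < i.+1%:R ^+ 3 * (binomial_pair n i.+1)%:R :> F.
    by apply: mulr_gt0 => //; apply: exprn_gt0; rewrite ltr0n.
  rewrite ger0_norm; last by rewrite -mulrA mulr_ge0 // ltW.
  rewrite lef_pV2 ?posrE; last 2 first.
  - by rewrite -mulrA mulr_gt0.
  - by rewrite mulr_gt0 ?natr1 ?ltr0n.
  by apply: le_trans le1 _; rewrite -mulrA; lra.
rewrite sumr_const card_ord -[_ *+ k]mulr_natl.
have n1 : 0 < n%:R :> F by rewrite ltr0n.
rewrite invfM mulrA; apply: ler_piMl; first by rewrite invr_ge0 natr1.
by rewrite ler_pdivrMr // mul1r ler_nat.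
Qed.

(** B_n / A_n is the average of [apery_c n k] with weights t(n,k)^2, and each of these is within
    1/(n+1) of the partial sum. *)
Lemma apery_ratio_close n :
  `|apery_ratio n - \sum_(i < n) i.+1%:R ^- 3| <= (n%:R + 1)^-1 :> F.
Proof.
have a0 := apery_a_gt0 (F := F) n.
pose H : F := \sum_(i < n) i.+1%:R ^- 3.
have e : apery_ratio n - H =
    (\sum_(k < n.+1) (binomial_pair n k)%:R ^+ 2 * (apery_c n k - H)) / a n.
  under eq_bigr do rewrite mulrBr.
  rewrite sumrB -mulr_suml -apery_aE -/(b n) /apery_ratio.
  by field; rewrite lt0r_neq0.
rewrite e normrM normfV (gtr0_norm a0) ler_pdivrMr //.
apply: le_trans (ler_norm_sum _ _ _) _.
rewrite [in X in _ <= X]apery_aE mulr_sumr; apply: ler_sum => k _.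
rewrite normrM normrX normr_nat mulrC ler_wpM2r ?exprn_ge0 //.
by apply: apery_c_close; rewrite -ltnS.
Qed.

(** A crude bound giving convergence of the series: 7 is B_0/A_0 + 6/A_0^2 = 6 plus the distance
    1/(n+1) <= 1. *)
Lemma sum_inv_cube_le n : \sum_(i < n) i.+1%:R ^- 3 <= 7 :> F.
Proof.
have := apery_ratio_close n; have := apery_ratio_upper (leq0n n).
rewrite /apery_ratio apery_b0 mul0r apery_a0 add0r expr1n divr1 => le6.
have pos : 0 <= 6 / a n ^+ 2 by rewrite divr_ge0 ?sqr_ge0.
have le1 : (n%:R + 1)^-1 <= 1 :> F by rewrite natr1 invf_le1 ?ltr0n // ler1n.
by rewrite ler_norml => /andP[le2 _]; lra.
Qed.

End Growth.

(** * Irrationality from denominators that grow more slowly than A_n *)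

Lemma bernoulli_ge (F : realFieldType) (x : F) (n : nat) : 0 <= x ->
  1 + n%:R * x <= (1 + x) ^+ n.
Proof.
move=> x0; elim: n => [|n IH]; first by rewrite mul0r addr0 expr0.
rewrite exprS -natr1; have n0 := ler0n F n.
have : (1 + x) * (1 + n%:R * x) <= (1 + x) * (1 + x) ^+ n.
  by rewrite ler_wpM2l // addr_ge0.
apply: le_trans; have : 0 <= n%:R * x * x by rewrite !mulr_ge0.
by move: (n%:R) => y h; rewrite -subr_ge0; lra.
Qed.

Section Irrationality.
Context {F : archiRealFieldType}.
Local Notation a := (@apery_a F).
Local Notation b := (@apery_b F).

Lemma apery_a_exp_ge (n : nat) : 33 ^+ n <= 33 ^+ 62 * a n.
Proof.
have [len|ltn] := leqP n 62.
  have le1 : 33 ^+ n <= 33 ^+ 62 :> F by rewrite ler_weXn2l // ler1n.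
  by apply: le_trans le1 _; rewrite ler_peMr ?exprn_ge0 // apery_a_ge1.
rewrite -(subnKC (ltnW ltn)); elim: (n - 62)%N => [|k IH].
  by rewrite addn0 ler_peMr ?exprn_ge0 // apery_a_ge1.
rewrite addnS exprS; have le1 := apery_a_lower33 (F := F) (leq_addr k 62).
apply: (@le_trans _ _ (33 * (33 ^+ 62 * a (62 + k)))); first by rewrite ler_wpM2l.
by rewrite mulrCA ler_wpM2l // exprn_ge0.
Qed.

Lemma lcm_upto_cube_small (C : F) : 0 < C ->
  exists n, C * (lcm_upto n)%:R ^+ 3 < a n.
Proof.
move=> C0; have [K leK] := lcm_upto_cube_le.
(* For n > c, Bernoulli gives (33/32)^n >= 1 + n/32 > C K 33^62, which beats all the constants. *)
pose c := C * K%:R * 33 ^+ 62 * 32.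
have c0 : 0 <= c by rewrite !mulr_ge0 ?exprn_ge0 // ltW.
exists (Num.truncn c).+1; set n := (Num.truncn c).+1.
have ltcn : c < n%:R by exact: Num.Theory.truncnS_gt.
have le1 : (lcm_upto n)%:R ^+ 3 <= K%:R * 32 ^+ n :> F.
  by have := leK n; rewrite -(ler_nat F) natrX natrM natrX.
have p62 : 0 < 33 ^+ 62 :> F by rewrite exprn_gt0.
rewrite -(ltr_pM2l p62); apply: lt_le_trans (apery_a_exp_ge n).
apply: (@le_lt_trans _ _ (33 ^+ 62 * (C * (K%:R * 32 ^+ n)))).
  by rewrite ler_wpM2l ?(ltW p62) // ler_wpM2l ?(ltW C0).
have -> : 33 ^+ n = 32 ^+ n * (1 + 32^-1) ^+ n :> F.
  by rewrite -exprMn; congr (_ ^+ n); field.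
have i32 : 0 <= 32^-1 :> F by rewrite invr_ge0.
have := bernoulli_ge n i32; have e32 : 0 < 32 ^+ n :> F by rewrite exprn_gt0.
have n0 := ler0n F n; clearbody n; rewrite /c in c0 ltcn.
move: (33 ^+ 62) (32 ^+ n) ((1 + _) ^+ n) (n%:R) c0 ltcn e32 n0 {p62 le1 c}.
move=> p y u x c0 ltcn y0 x0 leu.
have -> : p * (C * (K%:R * y)) = y * (C * K%:R * p) by ring.
by rewrite ltr_pM2l //; lra.
Qed.

(** If z had denominator d, then 2 lcm(1..n)^3 (z A_n - B_n) d would be an integer. It is positive
    and at most 12 d lcm(1..n)^3 / A_n, which is below 1 for some n. *)
Lemma apery_irrational (z : F) :
  (forall n, apery_ratio n < z) -> (forall n, z <= apery_ratio n + 6 / a n ^+ 2) ->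
  forall q : rat, z <> ratr q.
Proof.
move=> lez gez q zq.
pose d : F := (denq q)%:~R.
have d0 : 0 < d by rewrite ltr0z denq_gt0.
have zd : z * d = (numq q)%:~R.
  by rewrite zq /d -ratr_int -rmorphM /= -[X in ratr (X * _)]divq_num_den mulfVK ?ratr_int // intr_eq0 denq_neq0.
have d12 : 0 < 12 * d by rewrite mulr_gt0.
have [n] := lcm_upto_cube_small d12.
have a0 := apery_a_gt0 (F := F) n.
set L : F := (lcm_upto n)%:R ^+ 3 => small.
have L0 : 0 < L by rewrite exprn_gt0 // ltr0n lcm_upto_gt0.
pose X := 2 * L * (z * a n - b n) * d.
have Xint : X \is a Num.int.
  have -> : X = 2 * L * a n * (numq q)%:~R - 2 * L * b n * d.
    by rewrite -zd /X; ring.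
  have Lint : L \is a Num.int by rewrite rpredX // Num.Theory.natr_int.
  apply: rpredB.
    by do !apply: rpredM => //; rewrite ?Num.Theory.natr_int ?Num.Theory.intr_int.
  by apply: rpredM; rewrite ?int_lcm_upto_apery_b ?Num.Theory.intr_int.
have X0 : 0 < X.
  have := lez n; rewrite /apery_ratio ltr_pdivrMr // => lt1.
  by apply: mulr_gt0 => //; apply: mulr_gt0; rewrite ?subr_gt0 // mulr_gt0.
have X1 : X < 1.
  have := gez n; rewrite -lerBlDl => le1.
  have e : z * a n - b n = (z - apery_ratio n) * a n.
    by rewrite /apery_ratio; field; rewrite lt0r_neq0.
  have le2 : z * a n - b n <= 6 / a n.
    rewrite e; apply: le_trans (ler_wpM2r (ltW a0) le1) _.
    by rewrite expr2 invfM mulrA mulfVK ?lt0r_neq0.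
  apply: (@le_lt_trans _ _ (12 * d * L / a n)); last by rewrite ltr_pdivrMr // mul1r.
  have -> : 12 * d * L / a n = 2 * L * (6 / a n) * d by field; rewrite lt0r_neq0.
  apply: ler_wpM2r (ltW d0) _ _ _; apply: ler_wpM2l le2.
  by rewrite mulr_ge0 // ltW.
case/Num.Theory.intrP: Xint => i Xi; move: X0 X1.
by rewrite Xi ltr0z -[1]/(1%:~R) ltr_int; lia.
Qed.

End Irrationality.

(** * The four-term recurrence *)

(* The sextics of the recurrence are (P2 P3 - B^2) and (P1 P2 - C^2) for
   A, B, C, D = (n+3)^3, (n+2)^3, (n+1)^3, n^3 and Pi the middle coefficients of
   the three-term recurrence at n, n+1, n+2. *)
Lemma product_recurrence (F : fieldType) (A B C D P1 P2 P3 : F)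
    (u0 u1 u2 u3 u4 v0 v1 v2 v3 v4 : F) :
  A * u4 = P3 * u3 - B * u2 -> B * u3 = P2 * u2 - C * u1 -> D * u0 = P1 * u1 - C * u2 ->
  A * v4 = P3 * v3 - B * v2 -> B * v3 = P2 * v2 - C * v1 -> D * v0 = P1 * v1 - C * v2 ->
  A * B ^+ 2 * P1 * (u4 * v3 + v4 * u3)
  - P1 * (P2 * P3 - B ^+ 2) * B * (u3 * v2 + v3 * u2)
  + P3 * (P1 * P2 - C ^+ 2) * C * (u2 * v1 + v2 * u1)
  - C ^+ 2 * D * P3 * (u1 * v0 + v1 * u0) = 0.
Proof.
move=> eu4 eu3 eu0 ev4 ev3 ev0.
(* Regrouping attaches to each outer term its coefficient A, B or D, so the hypotheses eliminate it
   without division and a polynomial identity in the terms of index 1 and 2 remains. *)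
have -> : A * B ^+ 2 * P1 * (u4 * v3 + v4 * u3) =
  P1 * B * ((A * u4) * (B * v3) + (A * v4) * (B * u3)) by ring.
have -> : P1 * (P2 * P3 - B ^+ 2) * B * (u3 * v2 + v3 * u2) =
  P1 * (P2 * P3 - B ^+ 2) * ((B * u3) * v2 + (B * v3) * u2) by ring.
have -> : C ^+ 2 * D * P3 * (u1 * v0 + v1 * u0) =
  C ^+ 2 * P3 * (u1 * (D * v0) + v1 * (D * u0)) by ring.
rewrite eu4 ev4.
have -> : P1 * B * ((P3 * u3 - B * u2) * (B * v3) + (P3 * v3 - B * v2) * (B * u3)) =
  P1 * (2 * P3 * (B * u3) * (B * v3) - B ^+ 2 * (u2 * (B * v3) + v2 * (B * u3))) by ring.
by rewrite eu3 ev3 eu0 ev0; ring.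
Qed.

Lemma recurrence_coefE (F : realFieldType) (x : F) :
  let P y : F := (2 * y + 1) * (17 * y ^+ 2 + 17 * y + 5) in
  [/\ (2 * x + 5) * (17 * x ^+ 2 + 85 * x + 107) = P (x + 2),
    1155%:R * x ^+ 6 + 13860%:R * x ^+ 5 + 68535%:R * x ^+ 4
         + 178680%:R * x ^+ 3 + 259059%:R * x ^+ 2 + 198156%:R * x + 62531%:R
      = P (x + 1) * P (x + 2) - ((x + 2) ^+ 3) ^+ 2
  & 1155%:R * x ^+ 6 + 6930%:R * x ^+ 5 + 16560%:R * x ^+ 4
         + 20040%:R * x ^+ 3 + 12954%:R * x ^+ 2 + 4308%:R * x + 584
      = P x * P (x + 1) - ((x + 1) ^+ 3) ^+ 2].
Proof. by move=> P; rewrite /P; split; ring. Qed.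

(** The polarised form of the product u_{n+1} u_n; taking u = v gives twice that product. *)
Lemma product_solution (R : realType) (u v : nat -> R) : apery_rec u -> apery_rec v ->
  is_solution (fun n => u n.+1 * v n + v n.+1 * u n).
Proof.
move=> ru rv [|m] // _; rewrite /recurrence_lhs /=; set x : R := m.+1%:R.
have coefE : apery_coef m.+1 = (2 * x + 1) * (17 * x ^+ 2 + 17 * x + 5) :> R.
  by rewrite /apery_coef -/x; ring.
have coef1E : apery_coef m.+2 =
    (2 * (x + 1) + 1) * (17 * (x + 1) ^+ 2 + 17 * (x + 1) + 5) :> R.
  by rewrite /apery_coef -natr1 -/x; ring.
have coef2E : apery_coef m.+3 =
    (2 * (x + 2) + 1) * (17 * (x + 2) ^+ 2 + 17 * (x + 2) + 5) :> R.
  by rewrite /apery_coef -[m.+3%:R]natr1 -[m.+2%:R]natr1 -/x; ring.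
have solve (w : nat -> R) : apery_rec w -> [/\
    (x + 3) ^+ 3 * w m.+4 = apery_coef m.+3 * w m.+3 - (x + 2) ^+ 3 * w m.+2,
    (x + 2) ^+ 3 * w m.+3 = apery_coef m.+2 * w m.+2 - (x + 1) ^+ 3 * w m.+1
  & x ^+ 3 * w m = apery_coef m.+1 * w m.+1 - (x + 1) ^+ 3 * w m.+2].
  move=> rw; have := rw m; have := rw m.+1; have := rw m.+2.
  rewrite -[m.+2%:R]natr1 -/x /x -[m.+1%:R]natr1.
  move: (apery_coef m.+3) (apery_coef m.+2) (apery_coef m.+1) => p3 p2 p1 e2 e1 e0.
  split; apply/eqP; rewrite -subr_eq0; apply/eqP.
  - by apply: etrans e2; ring.
  - by apply: etrans e1; ring.
  - by apply: etrans e0; ring.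
have [u4 u3 u0] := solve u ru; have [v4 v3 v0] := solve v rv.
have := product_recurrence u4 u3 u0 v4 v3 v0; rewrite coefE coef1E coef2E.
have [-> -> ->] := recurrence_coefE x; move: (_ m) => y e; apply: etrans e.
ring.
Qed.

Local Open Scope classical_set_scope.

(* Keeping the numerals of the recurrence as arguments of type [nat] prevents
   rewriting with [rmorphM] and [rmorphD] from unfolding them. *)
Definition affine (F : pzRingType) (c d : nat) (x : F) : F := c%:R * x + d%:R.

Definition quadratic (F : pzRingType) (b c d : nat) (x : F) : F :=
  b%:R * x ^+ 2 + c%:R * x + d%:R.

Definition sextic (F : pzRingType) (c6 c5 c4 c3 c2 c1 c0 : nat) (x : F) : F :=
  c6%:R * x ^+ 6 + c5%:R * x ^+ 5 + c4%:R * x ^+ 4 + c3%:R * x ^+ 3 + c2%:R * x ^+ 2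
  + c1%:R * x + c0%:R.

Definition shift_pow (F : pzRingType) (d k : nat) (x : F) : F := (x + d%:R) ^+ k.

Lemma rmorph_affine (F G : pzRingType) (f : {rmorphism F -> G}) c d x :
  f (affine c d x) = affine c d (f x).
Proof. by rewrite rmorphD rmorphM !rmorph_nat. Qed.

Lemma rmorph_quadratic (F G : pzRingType) (f : {rmorphism F -> G}) b c d x :
  f (quadratic b c d x) = quadratic b c d (f x).
Proof. by rewrite !rmorphD ![f (_%:R * _)]rmorphM !rmorphXn !rmorph_nat. Qed.

Lemma rmorph_sextic (F G : pzRingType) (f : {rmorphism F -> G}) c6 c5 c4 c3 c2 c1 c0 x :
  f (sextic c6 c5 c4 c3 c2 c1 c0 x) = sextic c6 c5 c4 c3 c2 c1 c0 (f x).
Proof. by rewrite !rmorphD ![f (_%:R * _)]rmorphM !rmorphXn !rmorph_nat. Qed.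

Lemma rmorph_shift_pow (F G : pzRingType) (f : {rmorphism F -> G}) d k x :
  f (shift_pow d k x) = shift_pow d k (f x).
Proof. by rewrite rmorphXn rmorphD rmorph_nat. Qed.

Lemma affine_gt0 (F : realFieldType) (c d : nat) (x : F) : 0 < x -> (0 < d)%N ->
  0 < affine c d x.
Proof. by move=> x0 d0; rewrite ltr_wpDl ?ltr0n // mulr_ge0 // ltW. Qed.

Lemma quadratic_gt0 (F : realFieldType) (b c d : nat) (x : F) : 0 < x -> (0 < d)%N ->
  0 < quadratic b c d x.
Proof.
move=> x0 d0; rewrite /quadratic -addrA ltr_wpDl ?affine_gt0 //.
by rewrite mulr_ge0 // exprn_ge0 // ltW.
Qed.

Lemma shift_pow_gt0 (F : realFieldType) (d k : nat) (x : F) : 0 < x ->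
  0 < shift_pow d k x.
Proof. by move=> x0; rewrite exprn_gt0 // ltr_pwDl. Qed.

(** * Convergence to zeta(3) and the solution space of the four-term recurrence *)

Section Limits.
Context {R : realType}.
Local Notation a := (@apery_a R).
Local Notation b := (@apery_b R).
Local Notation r := (@apery_ratio R).

Lemma cvg_zeta3 : (fun n : nat => \sum_(i < n) i.+1%:R ^- 3 : R) @ \oo --> zeta3 R.
Proof.
have e : [series (n.+1%:R ^- 3 : R)]_n = (fun n : nat => \sum_(i < n) i.+1%:R ^- 3 : R).
  by apply/funext => n; rewrite /series /= big_mkord.
rewrite /zeta3 e; apply: nondecreasing_is_cvgn; last first.
  by exists 7 => _ [n _ <-]; exact: sum_inv_cube_le.
apply/nondecreasing_seqP => n; rewrite big_ord_recr /= lerDl.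
by rewrite invr_ge0 exprn_ge0.
Qed.

Lemma cvg0_dominated (f g : nat -> R) (c : R) :
  (forall n, `|f n| <= c * `|g n|) -> g @ \oo --> (0 : R) -> f @ \oo --> (0 : R).
Proof.
move=> lefg g0; apply/norm_cvg0P.
apply: (@squeeze_cvgr _ _ _ _ (cst 0) (fun n => c * `|g n|)).
- by apply: nearW => n; rewrite normr_ge0 lefg.
- exact: cvg_cst.
- rewrite -(mulr0 c) -(normr0 R); apply: cvgMr; exact: cvg_norm g0.
Qed.

Lemma cvg_apery_ratio : r @ \oo --> zeta3 R.
Proof.
pose s (n : nat) : R := \sum_(i < n) i.+1%:R ^- 3.
have -> : r = (fun n => (r n - s n) + s n) by apply/funext => n; rewrite subrK.
rewrite -[zeta3 R]add0r; apply: cvgD; last exact: cvg_zeta3.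
apply: (@cvg0_dominated _ (@harmonic R) 1); last exact: cvg_harmonic.
move=> n; have -> : `|harmonic n| = (n%:R + 1)^-1 :> R.
  by rewrite /harmonic /= ger0_norm ?invr_ge0 // natr1.
by rewrite mul1r; exact: apery_ratio_close.
Qed.

Lemma apery_ratio_lt_zeta3 n : r n < zeta3 R.
Proof.
apply: lt_le_trans (apery_ratio_lt n) _.
rewrite -(cvg_lim _ cvg_apery_ratio) //; apply: nondecreasing_cvgn_le.
  by move=> i j; exact: apery_ratio_mono.
by apply/cvg_ex; exists (zeta3 R); exact: cvg_apery_ratio.
Qed.

Lemma zeta3_le_apery_ratio n : zeta3 R <= r n + 6 / a n ^+ 2.
Proof.
rewrite -(cvg_lim _ cvg_apery_ratio) //; apply: limr_le.
  by apply/cvg_ex; exists (zeta3 R); exact: cvg_apery_ratio.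
near=> m; apply: le_trans (apery_ratio_upper (n := m) (m := n) _).
  by rewrite lerDl divr_ge0 ?sqr_ge0.
by near: m; exact: nbhs_infty_ge.
Unshelve. all: by end_near. Qed.

Lemma zeta3_irrational (q : rat) : zeta3 R <> ratr q.
Proof. exact: apery_irrational apery_ratio_lt_zeta3 zeta3_le_apery_ratio q. Qed.

(** The coefficients come from the subfield, and the outer ones are nonzero for n >= 1, so the
    recurrence can be solved forwards and backwards within that subfield. *)
Lemma recurrence_lhs_morph (F : realFieldType) (f : {rmorphism F -> R}) (n : nat) :
  (1 <= n)%N -> exists c3 c2 c1 c0 : F,
  [/\ c3 != 0, c0 != 0 & forall z : nat -> R, recurrence_lhs z n =
    f c3 * z n.+2 - f c2 * z n.+1 + f c1 * z n - f c0 * z n.-1].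
Proof.
move=> n0; pose x : F := n%:R; have x0 : 0 < x by rewrite ltr0n.
exists (shift_pow 3 3 x * shift_pow 2 6 x * affine 2 1 x * quadratic 17 17 5 x).
exists (affine 2 1 x * quadratic 17 17 5 x
  * sextic 1155 13860 68535 178680 259059 198156 62531 x * shift_pow 2 3 x).
exists (affine 2 5 x * quadratic 17 85 107 x
  * sextic 1155 6930 16560 20040 12954 4308 584 x * shift_pow 1 3 x).
exists (shift_pow 1 6 x * x ^+ 3 * affine 2 5 x * quadratic 17 85 107 x).
split; [apply: lt0r_neq0 | apply: lt0r_neq0 | move=> z].
- apply: mulr_gt0; last exact: quadratic_gt0.
  apply: mulr_gt0; last exact: affine_gt0.
  by apply: mulr_gt0; exact: shift_pow_gt0.
- apply: mulr_gt0; last exact: quadratic_gt0.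
  apply: mulr_gt0; last exact: affine_gt0.
  by apply: mulr_gt0; [exact: shift_pow_gt0 | exact: exprn_gt0].
- have M4 p q s t : f (p * q * s * t) = f p * f q * f s * f t by rewrite !rmorphM.
  rewrite !M4 !rmorph_shift_pow !rmorph_affine !rmorph_quadratic !rmorph_sextic.
  by rewrite rmorphXn (rmorph_nat f n).
Qed.

Lemma recurrence_lhs_rat (n : nat) : (1 <= n)%N -> exists c3 c2 c1 c0 : rat,
  [/\ c3 != 0, c0 != 0 & forall z : nat -> R, recurrence_lhs z n =
    ratr c3 * z n.+2 - ratr c2 * z n.+1 + ratr c1 * z n - ratr c0 * z n.-1].
Proof. exact: (recurrence_lhs_morph (ratr : {rmorphism rat -> R})). Qed.

Definition product_comb (x y z : R) (n : nat) : R :=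
  x * (a n.+1 * a n) + y * (a n.+1 * b n + b n.+1 * a n) + z * (b n.+1 * b n).

Lemma product_comb_solution (x y z : R) : is_solution (product_comb x y z).
Proof.
move=> n n0; have [c3 [c2 [c1 [c0 [_ _ e]]]]] := recurrence_lhs_rat n0.
have := product_solution (@apery_a_rec R) (@apery_a_rec R) n0.
have := product_solution (@apery_a_rec R) (@apery_b_rec R) n0.
have := product_solution (@apery_b_rec R) (@apery_b_rec R) n0.
rewrite !e /product_comb /= => ebb eab eaa.
(* The halves compensate for the doubling of A_{n+1} A_n and B_{n+1} B_n in [product_solution]. *)
apply: (@etrans _ _ (x / 2 * 0 + y * 0 + z / 2 * 0)); last by rewrite !mulr0 !addr0.
by rewrite -{1}eaa -{1}eab -{1}ebb; field.
Qed.

Lemma solution_eq (z w : nat -> R) : is_solution z -> is_solution w ->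
  z 0%N = w 0%N -> z 1%N = w 1%N -> z 2%N = w 2%N -> z =1 w.
Proof.
move=> sz sw e0 e1 e2 n.
suff [] : [/\ z n = w n, z n.+1 = w n.+1 & z n.+2 = w n.+2] by [].
elim: n => [//|n [f0 f1 f2]]; split=> //.
have [c3 [c2 [c1 [c0 [c3n _ e]]]]] := recurrence_lhs_rat (ltn0Sn n).
have c3n' : ratr c3 != 0 :> R by rewrite fmorph_eq0.
apply: (mulfI c3n'); have := sw _ (ltn0Sn n); rewrite -(sz _ (ltn0Sn n)) !e /=.
by rewrite f0 f1 f2 => /addIr /addIr /addIr ->.
Qed.

(** Rationality is assumed from index 1 on; the recurrence at n = 1, divided by its nonzero last
    coefficient, carries it to index 0. *)
Lemma solution_rat0 (z : nat -> R) : is_solution z ->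
  (forall n : nat, (1 <= n)%N -> exists q : rat, z n = ratr q) ->
  exists q : rat, z 0%N = ratr q.
Proof.
move=> sz ratz; have [c3 [c2 [c1 [c0 [_ c0n e]]]]] := recurrence_lhs_rat (ltn0Sn 0).
have [q1 e1] := ratz 1%N isT; have [q2 e2] := ratz 2%N isT.
have [q3 e3] := ratz 3%N isT.
have c0n' : ratr c0 != 0 :> R by rewrite fmorph_eq0.
exists ((c3 * q3 - c2 * q2 + c1 * q1) / c0).
rewrite !(rmorphM, fmorphV, rmorphD, rmorphN) /= -e1 -e2 -e3.
apply: (mulIf c0n'); rewrite mulfVK // mulrC.
by have := sz 1%N isT; rewrite e /= => /eqP; rewrite subr_eq0 => /eqP <-.
Qed.

Lemma cvg_product_comb (x y z : R) :
  (fun n => product_comb x y z n / (a n.+1 * a n)) @ \oo -->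
  x + 2 * y * zeta3 R + z * zeta3 R ^+ 2.
Proof.
have -> : (fun n => product_comb x y z n / (a n.+1 * a n)) =
    (fun n => x + y * (r n + r n.+1) + z * (r n.+1 * r n)).
  apply/funext => n; rewrite /product_comb /apery_ratio; field.
  by rewrite !lt0r_neq0 ?apery_a_gt0.
have rS : (fun n => r n.+1) @ \oo --> zeta3 R by rewrite cvg_shiftS; exact: cvg_apery_ratio.
have -> : x + 2 * y * zeta3 R + z * zeta3 R ^+ 2 =
  x + y * (zeta3 R + zeta3 R) + z * (zeta3 R * zeta3 R) by ring.
apply: cvgD; last by apply: cvgMr; apply: cvgM => //; exact: cvg_apery_ratio.
apply: cvgD; first exact: cvg_cst.
by apply: cvgMr; apply: cvgD => //; exact: cvg_apery_ratio.
Qed.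

Lemma apery_a_pred_le n : a n.-1 <= a n.+1.
Proof.
have step m : a m <= a m.+1.
  by apply: le_trans (apery_a_lower m); rewrite ler_peMl ?ler1n // ltW // apery_a_gt0.
by case: n => [|n] /=; [exact: step | exact: le_trans (step _) (step _)].
Qed.

Lemma apery_a_le_pred n : a n.+1 <= 34 * 34 * a n.-1.
Proof.
have up := @apery_a_upper R; case: n => [|n] /=; last first.
  by apply: le_trans (up _) _; rewrite -mulrA ler_wpM2l.
by apply: le_trans (up _) _; rewrite -mulrA ler_wpM2l // ler_peMl ?ler1n // ltW // apery_a_gt0.
Qed.

Lemma cvg0_apery_shift (S : nat -> R) :
  (fun n => S n / ((apery_A n)%:R * (apery_A n.-1)%:R)) @ \oo --> (0 : R) <->
  (fun n => S n / (a n.+1 * a n)) @ \oo --> (0 : R).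
Proof.
have gt0 n : 0 < a n.+1 * a n by rewrite mulr_gt0 ?apery_a_gt0.
have gt0' n : 0 < a n * a n.-1 by rewrite mulr_gt0 ?apery_a_gt0.
split; [apply: (@cvg0_dominated _ _ 1) => n | apply: (@cvg0_dominated _ _ (34 * 34)) => n].
all: rewrite -/(a n) -/(a n.-1) !normrM !normfV.
all: rewrite (gtr0_norm (gt0 n)) (gtr0_norm (gt0' n)).
all: rewrite mulrCA ler_wpM2l // ?mul1r.
- by rewrite lef_pV2 ?posrE // mulrC ler_pM2r ?apery_a_gt0 // apery_a_pred_le.
- rewrite ler_pdivlMr // mulrC -[_ * _^-1]/(_ / _) ler_pdivrMr //.
  by rewrite [_ * a n.-1]mulrC mulrA ler_pM2r ?apery_a_gt0 // apery_a_le_pred.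
Qed.

Lemma cvg_product_comb0 (x y z : R) :
  (fun n => product_comb x y z n / (a n.+1 * a n)) @ \oo --> (0 : R) <->
  x + 2 * y * zeta3 R + z * zeta3 R ^+ 2 = 0.
Proof.
split=> [lim0|<-]; last exact: cvg_product_comb.
by rewrite -(cvg_lim _ (@cvg_product_comb x y z)) // (cvg_lim _ lim0).
Qed.

Lemma apery_values : [/\ a 2 = 73, a 3 = 1445%:R, b 2 = 351 / 4 & b 3 = 62531%:R / 36].
Proof.
have step (u : nat -> R) : apery_rec u -> u 2 = (117 * u 1%N - u 0%N) / 8 /\
    u 3 = (535 * u 2 - 8 * u 1%N) / 27.
  move=> ru; have := ru 0%N; have := ru 1%N; rewrite /apery_coef => e1 e0; split.
    by apply: (mulIf (_ : 8 != 0 :> R)); rewrite ?mulfVK //; lra.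
  by apply: (mulIf (_ : 27 != 0 :> R)); rewrite ?mulfVK //; lra.
have [a2 a3] := step _ (@apery_a_rec R); have [b2 b3] := step _ (@apery_b_rec R).
rewrite a3 b3 a2 b2 apery_a0 apery_a1 apery_b0 apery_b1.
by split; field.
Qed.

Lemma product_comb_values (x y z : R) : [/\
    product_comb x y z 0 = 5 * x + 6 * y,
    product_comb x y z 1 = 365 * x + 3507%:R / 4 * y + 1053%:R / 2 * z
  & product_comb x y z 2 = 105485%:R * x + 4564759%:R / 18 * y + 2438709%:R / 16 * z].
Proof.
have [a2 a3 b2 b3] := apery_values.
rewrite /product_comb a3 b3 a2 b2 apery_a1 apery_b1 apery_a0 apery_b0.
by split; field.
Qed.

Lemma product_comb_initial (s0 s1 s2 : rat) : exists x y z : rat,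
  [/\ product_comb (ratr x) (ratr y) (ratr z) 0 = ratr s0,
      product_comb (ratr x) (ratr y) (ratr z) 1 = ratr s1
    & product_comb (ratr x) (ratr y) (ratr z) 2 = ratr s2].
Proof.
have solve (F : realFieldType) (t0 t1 t2 : F) : exists x y z : F,
    [/\ 5 * x + 6 * y = t0,
        365 * x + 3507%:R / 4 * y + 1053%:R / 2 * z = t1
      & 105485%:R * x + 4564759%:R / 18 * y + 2438709%:R / 16 * z = t2].
  (* The three witnesses are the rows of the inverse matrix of the system. Solving over any field F
     gives rational x, y, z when F is [rat]. *)
  exists (117 * t0 - 500248%:R / 535 * t1 + 1728%:R / 535 * t2).
  exists (- (292 / 3) * t0 + 250124%:R / 321 * t1 - 288 / 107 * t2).
  exists (85264%:R / 1053%:R * t0 - 73161056%:R / 112671%:R * t1 + 240 / 107 * t2).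
  by split; field.
have [x [y [z [e0 e1 e2]]]] := solve rat s0 s1 s2.
have morph2 (f : {rmorphism rat -> R}) (c d : nat) (p q : rat) :
    c%:R * f p + d%:R * f q = f (c%:R * p + d%:R * q).
  by rewrite rmorphD !rmorphM !rmorph_nat.
have morph3 (f : {rmorphism rat -> R}) (c d e k l : nat) (p q t : rat) :
    c%:R * f p + d%:R / k%:R * f q + e%:R / l%:R * f t =
    f (c%:R * p + d%:R / k%:R * q + e%:R / l%:R * t).
  by rewrite !rmorphD !rmorphM !fmorphV !rmorph_nat.
exists x, y, z; have [-> -> ->] := product_comb_values (ratr x) (ratr y) (ratr z).
rewrite -e0 -e1 -e2; split.
- exact: (morph2 ratr _ _ x y).
- exact: (morph3 ratr _ _ _ _ _ x y z).
- exact: (morph3 ratr _ _ _ _ _ x y z).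
Qed.

(** The system for the first three terms is invertible, so they cannot all vanish when the
    coefficient of B_{n+1} B_n is 1. *)
Lemma product_comb_neq0 (x y : R) : exists n, product_comb x y 1 n != 0.
Proof.
have [e0 e1 e2] := product_comb_values x y 1.
have [z0|] := eqVneq (product_comb x y 1 0) 0; last by exists 0%N.
have [z1|] := eqVneq (product_comb x y 1 1) 0; last by exists 1%N.
exists 2; apply/eqP => z2; rewrite z0 in e0; rewrite z1 in e1; rewrite z2 in e2.
lra.
Qed.

End Limits.

(** * Numbers of degree two *)

Lemma ratr_apery_c (R : realType) n k : ratr (apery_c n k) = apery_c n k :> R.
Proof.
rewrite /apery_c rmorphD !rmorph_sum; congr (_ + _); apply: eq_bigr => i _ /=.
  by rewrite fmorphV rmorphXn rmorph_nat.
by rewrite rmorphM fmorphV !rmorphM !rmorphXn rmorphN1 !rmorph_nat.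
Qed.

Lemma ratr_apery_b (R : realType) n : ratr (apery_b n) = apery_b n :> R.
Proof.
rewrite /apery_b rmorph_sum; apply: eq_bigr => i _ /=.
by rewrite rmorphM rmorphXn rmorph_nat /= ratr_apery_c.
Qed.

Section QuadraticAlgebraic.
Context {R : realType}.

Lemma horner_ratr_wide (p : {poly rat}) (x : R) (n : nat) : (size p <= n)%N ->
  (map_poly ratr p).[x] = \sum_(i < n) ratr p`_i * x ^+ i.
Proof.
move=> lepn; rewrite (@horner_coef_wide _ n) ?size_map_poly //.
by apply: eq_bigr => i _; rewrite coef_map.
Qed.

Lemma degree2_root (x : R) : algebraic_of_degree 2 x ->
  exists b c : rat, x ^+ 2 + ratr b * x + ratr c = 0.
Proof.
case=> p [pmonic /rootP px0 _] p3; exists p`_1, p`_0.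
have p2 : p`_2 = 1 by have /monicP := pmonic; rewrite lead_coefE p3.
move: px0; rewrite (@horner_ratr_wide p x 3) ?p3 // !big_ord_recr big_ord0 /= p2.
by rewrite rmorph1 => <-; ring.
Qed.

(** A root of a polynomial q_1 X + q_0 is -q_0/q_1, hence rational, unless q_1 = 0; then q_0 = 0 as
    well. *)
Lemma irrational_root_size (x : R) (q : {poly rat}) : (forall t : rat, x <> ratr t) ->
  q != 0 -> root (map_poly ratr q) x -> (2 < size q)%N.
Proof.
move=> irr q0 /rootP qx; rewrite ltnNge; apply/negP => leq2; move: qx.
rewrite (horner_ratr_wide x leq2) !big_ord_recr big_ord0 /= add0r mulr1.
have [q1|q1] := eqVneq q`_1 0; last first.
  move=> e; apply: (irr (- q`_0 / q`_1)).
  have q1' : ratr q`_1 != 0 :> R by rewrite fmorph_eq0.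
  rewrite rmorphM rmorphN fmorphV; apply: (mulfI q1').
  rewrite mulrCA divff // mulr1; apply/eqP; rewrite -addr_eq0 addrC.
  by rewrite -[_ * x]/(_ * x ^+ 1) e.
rewrite q1 rmorph0 mul0r addr0 => /eqP; rewrite fmorph_eq0 => /eqP e0.
case/eqP: q0; apply/polyP => i; rewrite coef0.
by case: i => [//|[//|i]]; rewrite nth_default // (leq_trans leq2).
Qed.

Lemma quadratic_degree2 (x : R) (b c : rat) : (forall t : rat, x <> ratr t) ->
  x ^+ 2 + ratr b * x + ratr c = 0 -> algebraic_of_degree 2 x.
Proof.
move=> irr e; pose p : {poly rat} := \poly_(i < 3) [:: c; b; 1]`_i.
have p3 : size p = 3%N by rewrite size_poly_eq ?oner_eq0.
exists p => //; split.
- by rewrite monicE lead_coefE p3 coef_poly.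
- apply/rootP; rewrite (@horner_ratr_wide p x 3) ?p3 //.
  rewrite !big_ord_recr big_ord0 /= !coef_poly /= rmorph1 -[RHS]e; ring.
- by move=> q q0 qx; rewrite p3; exact: irrational_root_size irr q0 qx.
Qed.

End QuadraticAlgebraic.

(** * Rational null solutions and quadratic relations for zeta(3) *)

Unset Implicit Arguments.

Theorem theorem3p4 (R : realType) :
  algebraic_of_degree 2 (zeta3 R) <->
  exists S : nat -> R,
    [/\ is_solution S,
        exists n : nat, S n != 0,
        forall n : nat, (1 <= n)%N -> exists q : rat, S n = ratr q
      & (fun n : nat => S n / ((apery_A n)%:R * (apery_A n.-1)%:R)) @ \oo --> (0 : R)].
Proof.
split.
  move=> /degree2_root [b [c e]].
  (* The limit x + 2y zeta(3) + z zeta(3)^2 becomes the monic quadratic relation for x = c, y = b/2,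
     z = 1. *)
  exists (product_comb (ratr c) (ratr b / 2) 1); split.
  - exact: product_comb_solution.
  - exact: product_comb_neq0.
  - move=> n _; exists (c * (apery_a n.+1 * apery_a n)
      + b / 2 * (apery_a n.+1 * apery_b n + apery_b n.+1 * apery_a n)
      + apery_b n.+1 * apery_b n).
    by rewrite /product_comb mul1r !(rmorphD, rmorphM) fmorphV !rmorph_nat /= !ratr_apery_b.
  - apply/cvg0_apery_shift/cvg_product_comb0.
    by rewrite -[RHS]e; field.
case=> S [solS [m Sm] ratS /cvg0_apery_shift lim0].
have [s0 e0] := solution_rat0 solS ratS.
have [s1 e1] := ratS 1%N isT; have [s2 e2] := ratS 2%N isT.
have [x [y [z [f0 f1 f2]]]] := @product_comb_initial R s0 s1 s2.
have eS : S =1 product_comb (ratr x) (ratr y) (ratr z).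
  apply: solution_eq => //; first exact: product_comb_solution.
  - by rewrite e0 f0.
  - by rewrite e1 f1.
  - by rewrite e2 f2.
move: lim0; rewrite (funext eS) => /cvg_product_comb0 e.
have irr := @zeta3_irrational R.
(* If z = 0, then y = 0 would force x = 0 and a trivial solution, while y != 0 would make zeta(3) =
   -x/(2y) rational. Otherwise dividing by z gives a monic quadratic relation. *)
have [z0|z0] := eqVneq z 0.
  have [y0|y0] := eqVneq y 0.
    have x0 : ratr x = 0 :> R by rewrite -[RHS]e z0 y0 rmorph0; ring.
    by case/eqP: Sm; rewrite eS /product_comb x0 y0 z0 rmorph0; ring.
  case: (irr (- x / (2 * y))).
  have y0' : ratr y != 0 :> R by rewrite fmorph_eq0.
  rewrite rmorphM rmorphN fmorphV rmorphM rmorph_nat.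
  have x2y : ratr x + 2 * ratr y * zeta3 R = 0 by rewrite -[RHS]e z0 rmorph0; ring.
  apply/eqP; rewrite -subr_eq0; apply/eqP.
  by rewrite -(mulr0 (2 * ratr y)^-1) -x2y; field.
have z0' : ratr z != 0 :> R by rewrite fmorph_eq0.
apply: (@quadratic_degree2 _ _ (2 * y / z) (x / z) irr).
rewrite !rmorphM !fmorphV rmorph_nat.
apply: (mulfI z0'); rewrite mulr0 -[RHS]e; field.
exact: z0'.
Qed.
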